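(* Let $\phi:\mathbb{N}\to(0,1)$ be a monotone function decreasing to zero, and let $\mu$ be the infinite convolution $$\mu=\mathop{\ast}_{n=1}^{\infty}\left(\tfrac12(1+\phi(n))\,\delta_0+\tfrac12(1-\phi(n))\,\delta_{2^{-n}}\right).$$ Then $\mu$-almost every point is absolutely normal.
   Context: $\mathbb{N}=\{1,2,3,\dots\}$; $\delta_x$ is the Dirac measure at $x$. The measure $\mu$ is the distribution of the random sum $S=\sum_{n\ge1}X_n2^{-n}$, where the $X_n$ are independent random variables with $P(X_n=0)=\tfrac12(1+\phi(n))$ and $P(X_n=1)=\tfrac12(1-\phi(n))$. A real number $x\in[0,1)$ is normal to an integer base $b\ge2$ if in its base-$b$ expansion every finite combination of digits occurs with the proper frequency ($b^{-L}$ for a block of length $L$); equivalently, the sequence $\{b^nx\}_{n\ge1}$ is uniformly distributed modulo one. The number $x$ is absolutely normal if it is normal to every integer base $b\ge2$. *)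

(* Defs.v *)
From HB Require Import structures.
From mathcomp Require Import all_boot all_order all_algebra.
From mathcomp Require Import all_classical all_reals all_analysis.

Set Implicit Arguments.
Unset Strict Implicit.
Unset Printing Implicit Defensive.

Import Order.TTheory GRing.Theory Num.Theory.
Import numFieldNormedType.Exports.

Local Open Scope classical_set_scope.
Local Open Scope ring_scope.

Section convolution.
Context {R : realType}.

Definition sum_pair (z : R * R) : R := z.1 + z.2.

Lemma measurable_sum_pair : measurable_fun setT sum_pair.
Proof.
apply: measurable_realfun.measurable_funD.
- exact: measurable_fst.
- exact: measurable_snd.
Qed.

HB.instance Definition _ :=
  isMeasurableFun.Build _ _ _ _ sum_pair measurable_sum_pair.

Definition convolution (P Q : probability R R) : probability R R :=
  distribution (P \x Q)%E sum_pair.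

(* nu 1 * ... * nu n; the value nu 0 is not used, and the empty convolution is
   the neutral element \d_0. *)
Fixpoint partial_convolution (nu : nat -> probability R R) (n : nat) :
    probability R R :=
  if n is n'.+1 then convolution (partial_convolution nu n') (nu n)
  else \d_(0 : R).

Definition weakly_converges (P : nat -> probability R R)
    (Q : probability R R) : Prop :=
  forall f : R -> R, continuous f -> bounded_fun f ->
    (\int[P n]_x (f x)%:E)%E @[n --> \oo] --> (\int[Q]_x (f x)%:E)%E.

(* The weak limit of the laws of X_1 + ... + X_n, X_k independent of law nu k:
   this is the law of the random series \sum_k X_k when the latter converges
   almost surely. *)
Definition is_infinite_convolution (nu : nat -> probability R R)
    (mu : probability R R) : Prop :=
  weakly_converges (partial_convolution nu) mu.

End convolution.

Section normality.
Context {R : realType}.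
Implicit Types (x : R) (b k L n : nat).

(* For 0 <= x < 1 and 0 < k, the k-th base-b digit after the point,
   floor (b ^ k x) mod b. *)
Definition digit b x k : nat := (Num.truncn (b%:R ^+ k * x) %% b)%N.

(* Number of occurrences of the block w starting at one of the digit
   positions 1, ..., n. *)
Definition block_count b x L (w : L.-tuple 'I_b) n : nat :=
  #|[pred k : 'I_n | [forall j : 'I_L, digit b x (k + j).+1 == tnth w j]]|.

Definition normal_to_base b x : Prop :=
  0 <= x < 1 /\
  forall L (w : L.-tuple 'I_b),
    (block_count x w n)%:R / n%:R @[n --> \oo] --> (b%:R ^- L : R).

Definition absolutely_normal x : Prop :=
  forall b, (2 <= b)%N -> normal_to_base b x.

End normality.

(* Main.v *)
Require Import Defs.
From mathcomp Require Import all_boot all_order all_algebra.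
From mathcomp Require Import all_classical all_reals all_analysis.
From mathcomp Require Import measurable_realfun.
From mathcomp Require Import ring lra zify.

(** By Weyl's criterion, x in [0, 1[ is normal to base b as soon as the Cesaro
    means of e(h b^n x), with e(u) = exp(2 i pi u), tend to 0 for every integer
    h > 0.  So it suffices to fix b and h and to prove this convergence for
    mu-almost every x; there are only countably many pairs (b, h).  Convergence
    almost everywhere follows from a second moment estimate: if the integral
    of the squared modulus of the sum of the first K terms is at most
    C K^2 rho^(log_2 K) for some rho < 1, then the means converge to 0 along
    the integers k^r, r large, and the gaps between these are too short to
    matter ([ae_mean_cvg0]).

    All integrals are limits of expectations over the first N binary digits
    ([bitE_cvg_integral]), for which the Fourier coefficient at t is a product:
    its squared modulus is the product over n of
      (1 + phi(n)^2) / 2 + (1 - phi(n)^2) / 2 * cos (2 pi t / 2^n)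
    ([bitE_fourier]).  Write b = 2^a b' with b' odd.

    If b' >= 3, the second moment is a sum of Fourier coefficients at
    h (b^d - 1) b^m.  As phi <= phi(1) < 1, each factor is below 1 by a margin
    unless t / 2^n is close to an integer.  For fixed d, the odd part of t is a
    constant times b'^m, and modulo 2^j the powers of b' run periodically
    through residues whose high binary digits are equidistributed.  Pairing
    residues that differ by half a period, where the cosine changes sign,
    evaluates exactly the sum over m of a product that bounds the squared
    coefficients ([sum_damping_orbit]); the result is smaller than the trivial
    bound by a power of K.

    If b' = 1, the digits themselves must become fair, and no rate is available,
    so the expectation is subtracted first.  Multiplication by 2^(a n) forgets
    the first a n digits, whereas e(h 2^(a m) x) with m < n almost depends on
    these digits only: covariances decay geometrically ([covariance_le]) and
    the centred sums have variance O(K).  The expectation of e(h 2^(a n) x) is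
    bounded by a single value of phi far out ([mean_power_of_two]), hence tends
    to 0.

    Finally, Weyl's criterion is proved with the Fejer kernel sampled on a grid:
    it yields upper bounds for the frequency of each block
    ([weyl_upper]), and these suffice because the frequencies of all blocks of
    a given length add up to 1. *)

Set Implicit Arguments.
Unset Strict Implicit.
Unset Printing Implicit Defensive.

Import Order.TTheory GRing.Theory Num.Theory.
Import numFieldNormedType.Exports.

Local Open Scope classical_set_scope.
Local Open Scope ring_scope.

(** * Cosine and sine of period one *)

Section circle_functions.
Context {R : realType}.
Implicit Types (x y : R).

Definition ecos x : R := cos (pi *+ 2 * x).
Definition esin x : R := sin (pi *+ 2 * x).

Lemma ecos0 : ecos 0 = 1. Proof. by rewrite /ecos mulr0 cos0. Qed.

Lemma ecosD x y : ecos (x + y) = ecos x * ecos y - esin x * esin y.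
Proof. by rewrite /ecos mulrDr cosD. Qed.

Lemma esinD x y : esin (x + y) = esin x * ecos y + ecos x * esin y.
Proof. by rewrite /esin mulrDr sinD. Qed.

Lemma ecosN x : ecos (- x) = ecos x.
Proof. by rewrite /ecos mulrN cosN. Qed.

Lemma esinN x : esin (- x) = - esin x.
Proof. by rewrite /esin mulrN sinN. Qed.

Lemma ecosB x y : ecos (x - y) = ecos x * ecos y + esin x * esin y.
Proof. by rewrite ecosD ecosN esinN; ring. Qed.

Lemma ecos2Desin2 x : ecos x ^+ 2 + esin x ^+ 2 = 1.
Proof. exact: cos2Dsin2. Qed.

Lemma ecos_le1 x : `|ecos x| <= 1.
Proof. by rewrite ler_norml cos_geN1 cos_le1. Qed.

Lemma esin_le1 x : `|esin x| <= 1.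
Proof. by rewrite ler_norml sin_geN1 sin_le1. Qed.

Lemma ecosDn x n : ecos (x + n%:R) = ecos x.
Proof.
rewrite /ecos mulrDr mulr_natr.
exact: (periodicn (@cosD2pi R)).
Qed.

Lemma esinDn x n : esin (x + n%:R) = esin x.
Proof.
rewrite /esin mulrDr mulr_natr.
exact: (periodicn (@sinD2pi R)).
Qed.

Lemma ecosDhalf x : ecos (x + 2^-1) = - ecos x.
Proof.
rewrite /ecos mulrDr -(cosDpi (pi *+ 2 * x)); congr (cos (_ + _)).
by rewrite mulr2n mulrDl -splitr.
Qed.

Lemma ecosDodd x o : odd o -> ecos (x + o%:R / 2) = - ecos x.
Proof.
move=> oo; rewrite -(odd_double_half o) oo -muln2 natrD natrM mulrDl mulfK//.
by rewrite div1r addrA ecosDn ecosDhalf.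
Qed.

Lemma continuous_ecos : continuous (ecos : R -> R).
Proof.
move=> x; apply: continuous_comp; last exact: continuous_cos.
by apply: continuousM; [exact: cvg_cst|exact: cvg_id].
Qed.

Lemma continuous_esin : continuous (esin : R -> R).
Proof.
move=> x; apply: continuous_comp; last exact: continuous_sin.
by apply: continuousM; [exact: cvg_cst|exact: cvg_id].
Qed.

(** Mean value theorem. *)
Lemma lipschitz_of_derive (f g : R -> R) :
  (forall x, is_derive x 1 f (g x)) -> (forall x, `|g x| <= 1) ->
  forall x y, `|f x - f y| <= `|x - y|.
Proof.
move=> df g1 x y; wlog xy : x y / y <= x => [H|].
  by have [/H//|/ltW/H] := leP y x; rewrite distrC (distrC y).
have [|c _ ->] := @MVT_segment R f g y x xy (fun x _ => df x).
  apply: continuous_subspaceT => z.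
  apply: differentiable_continuous; apply/derivable1_diffP.
  by have [] := df z.
by rewrite normrM ler_piMl.
Qed.

Lemma ecos_lip x y : `|ecos x - ecos y| <= pi *+ 2 * `|x - y|.
Proof.
have := @lipschitz_of_derive cos (fun x => - sin x) _ _
          (pi *+ 2 * x) (pi *+ 2 * y).
rewrite -mulrBr normrM (ger0_norm (_ : 0 <= pi *+ 2 :> R)); last first.
  by rewrite mulrn_wge0// pi_ge0.
by apply=> z; rewrite normrN ler_norml sin_geN1 sin_le1.
Qed.

Lemma esin_lip x y : `|esin x - esin y| <= pi *+ 2 * `|x - y|.
Proof.
have := @lipschitz_of_derive sin cos _ _ (pi *+ 2 * x) (pi *+ 2 * y).
rewrite -mulrBr normrM (ger0_norm (_ : 0 <= pi *+ 2 :> R)); last first.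
  by rewrite mulrn_wge0// pi_ge0.
by apply=> z; rewrite ler_norml cos_geN1 cos_le1.
Qed.

End circle_functions.

(** * Expectations over finitely many random binary digits *)

Section random_binary_digits.
Context {R : realType}.
Context (phi : nat -> R).
Implicit Types (f g : R -> R) (m k n : nat).

(** The expectation of f at the sum of X_j / 2^j over m < j <= m + k.  The
    recursion peels off the last digit, as a convolution with one more factor
    does. *)
Fixpoint bitE m k f : R :=
  if k is k'.+1 then
    2^-1 * (1 + phi (m + k)) * bitE m k' f +
    2^-1 * (1 - phi (m + k)) * bitE m k' (fun x => f (x + 2 ^- (m + k)))
  else f 0.

Lemma bitE_ext m k f g : f =1 g -> bitE m k f = bitE m k g.
Proof. by move=> /funext ->. Qed.

Lemma bitED m k f g :
  bitE m k (fun x => f x + g x) = bitE m k f + bitE m k g.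
Proof. by elim: k f g => //= k IH f g; rewrite !IH; ring. Qed.

Lemma bitEZ m k c f : bitE m k (fun x => c * f x) = c * bitE m k f.
Proof. by elim: k f => //= k IH f; rewrite !IH; ring. Qed.

Lemma bitE_cst m k c : bitE m k (fun=> c) = c.
Proof. by elim: k => //= k ->; field. Qed.

Lemma bitE_sum m k I (r : seq I) (F : I -> R -> R) :
  bitE m k (fun x => \sum_(i <- r) F i x) = \sum_(i <- r) bitE m k (F i).
Proof.
elim: r => [|i r IH].
  rewrite big_nil -[RHS](@bitE_cst m k 0).
  by apply: bitE_ext => x; rewrite big_nil.
rewrite big_cons -IH -bitED; apply: bitE_ext => x; by rewrite big_cons.
Qed.

(** Independence of the first a digits from the next k. *)
Lemma bitE_split a k f :
  bitE 0 (a + k) f = bitE a k (fun z => bitE 0 a (fun y => f (y + z))).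
Proof.
elim: k f => [|k IH] f; first by rewrite addn0 /=; apply: bitE_ext => x; rewrite addr0.
rewrite addnS /= !IH !add0n -!addnS; congr (_ * _ + _ * _).
by apply: bitE_ext => z; apply: bitE_ext => y; rewrite addrA.
Qed.

(** The squared modulus of the Fourier coefficient of the n-th digit; u is the
    frequency divided by 2^n. *)
Definition bit_factor (n : nat) (u : R) : R :=
  (1 + phi n ^+ 2) / 2 + (1 - phi n ^+ 2) / 2 * ecos u.

(** Adding an independent digit multiplies the complex Fourier coefficient by
    that of the digit, so the squared moduli multiply. *)
Lemma bitE_fourier m k t :
  bitE m k (fun x => ecos (t * x)) ^+ 2 + bitE m k (fun x => esin (t * x)) ^+ 2
  = \prod_(j < k) bit_factor (m + j.+1) (t / 2 ^+ (m + j.+1)).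
Proof.
elim: k => [|k IH]; first by rewrite big_ord0 /= ecos2Desin2.
rewrite big_ord_recr /= -IH /=.
set n := (m + k.+1)%N; set c := bitE _ _ _; set s := bitE _ _ (fun x => esin (t * x)).
rewrite /bit_factor; set u := t / 2 ^+ n.
have -> : bitE m k (fun x => ecos (t * (x + 2 ^- n)))
    = ecos u * c - esin u * s.
  rewrite /c /s -!bitEZ -mulN1r -bitEZ -bitED; apply: bitE_ext => x.
  by rewrite mulrDr ecosD -/u; ring.
have -> : bitE m k (fun x => esin (t * (x + 2 ^- n)))
    = esin u * c + ecos u * s.
  rewrite /c /s -!bitEZ -bitED; apply: bitE_ext => x.
  by rewrite mulrDr esinD -/u; ring.
move: (ecos2Desin2 u) => /(canRL (addrK _)); set C := ecos u; set S := esin u.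
move=> HC.
have HS : S ^+ 2 = 1 - C ^+ 2 by rewrite HC; ring.
transitivity ((c ^+ 2 + s ^+ 2) *
  ((2^-1 * (1 + phi n) + 2^-1 * (1 - phi n) * C) ^+ 2
   + (2^-1 * (1 - phi n)) ^+ 2 * S ^+ 2)); first by ring.
by rewrite HS; field.
Qed.

Context (phi01 : forall n, (1 <= n)%N -> 0 < phi n < 1).

(** The first m + k digits only produce multiples of 2^-(m + k), so it is enough
    to compare the functions there. *)
Lemma bitE_le m k f g :
  (forall i, (i < 2 ^ k)%N -> f (i%:R / 2 ^+ (m + k)) <= g (i%:R / 2 ^+ (m + k))) ->
  bitE m k f <= bitE m k g.
Proof.
elim: k f g => [|k IH] f g H /=; first by have := H 0 isT; rewrite mul0r.
have/andP[p0 p1] : 0 < phi (m + k.+1) < 1 by apply: phi01; rewrite addnS.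
have E (i : nat) : i%:R / 2 ^+ (m + k) = i.*2%:R / 2 ^+ (m + k.+1) :> R.
  rewrite addnS exprS invfM -muln2 natrM -mulrA mulVKf//.
apply: lerD; apply: ler_wpM2l; try (by lra); apply: IH => i ik.
  rewrite E; apply: H; rewrite expnS; lia.
have -> : i%:R / 2 ^+ (m + k) + 2 ^- (m + k.+1) = i.*2.+1%:R / 2 ^+ (m + k.+1) :> R.
  by rewrite E -(natr1 i.*2) mulrDl mul1r.
by apply: H; rewrite expnS; lia.
Qed.

Lemma bitE_eq m k f g :
  (forall i, (i < 2 ^ k)%N -> f (i%:R / 2 ^+ (m + k)) = g (i%:R / 2 ^+ (m + k))) ->
  bitE m k f = bitE m k g.
Proof.
by move=> H; apply/le_anti; rewrite !bitE_le// => i ik; rewrite H.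
Qed.

Lemma bitE_dist m k f g c :
  (forall i, (i < 2 ^ k)%N ->
     `|f (i%:R / 2 ^+ (m + k)) - g (i%:R / 2 ^+ (m + k))| <= c) ->
  `|bitE m k f - bitE m k g| <= c.
Proof.
move=> H; rewrite ler_distlC.
have E d : bitE m k f + d = bitE m k (fun x => f x + d).
  by rewrite bitED bitE_cst.
by apply/andP; split; rewrite E; apply: bitE_le => i /H;
  rewrite ler_distlC => /andP[].
Qed.

End random_binary_digits.

(** * Powers of an odd number modulo powers of two *)

Section orbit_of_odd_base.
Context {R : realType}.

(** Squaring 1 + 2^e o, with o odd and e >= 2, raises the exponent e by exactly
    one; the square of an odd number is 1 modulo 4, which starts the induction. *)
Lemma odd_pow_two_power (b : nat) : odd b -> (3 <= b)%N ->
  exists s, forall J, exists2 o, odd o &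
    (b ^ (2 ^ J.+1) = 1 + 2 ^ (s + J) * o)%N.
Proof.
move=> ob b3.
have H0 : (0 < b ^ 2 - 1)%N by rewrite subn_gt0 expnS expn1; nia.
have s2 : (2 <= logn 2 (b ^ 2 - 1))%N.
  rewrite -(@pfactor_dvdn 2 2)//; apply/dvdnP.
  exists (b./2 * (b./2).+1)%N; set c := b./2.
  have -> : b = (2 * c + 1)%N by rewrite -[LHS]odd_double_half ob /c; lia.
  rewrite !expnS !expn0; nia.
have [q oq Eq] := pfactor_coprime (isT : prime 2) H0.
exists (logn 2 (b ^ 2 - 1)).
rewrite coprime2n in oq.
set s := logn 2 _ in Eq s2 *.
elim=> [|J [r or IH]].
  by exists q => //; rewrite addn0 expn1; lia.
(* Cofactor in (1 + 2^e r)^2 = 1 + 2^(e + 1) (r + 2^(e - 1) r^2). *)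
exists (r + 2 ^ (s + J).-1 * r ^ 2)%N.
  rewrite oddD or oddM oddX /=; case: (s + J)%N (leq_trans s2 (leq_addr J s)) => [|[|n]]//.
rewrite expnSr expnM IH addnS (expnS 2 (s + J)).
have -> : (2 ^ (s + J) = 2 * 2 ^ (s + J).-1)%N.
  by rewrite -expnS prednK// (leq_trans _ (leq_addr J s))// ltnW.
by move: (2 ^ _)%N => P; rewrite !expnS !expn0; ring.
Qed.

(** Dominates every [bit_factor] when kappa = 1 - phi(1)^2. *)
Definition damping (kappa u : R) : R := 1 - kappa / 2 + kappa / 2 * ecos u.

Lemma dampingDn kappa u n : damping kappa (u + n%:R) = damping kappa u.
Proof. by rewrite /damping ecosDn. Qed.

Lemma dampingDodd kappa u o : odd o ->
  damping kappa u + damping kappa (u + o%:R / 2) = 2 - kappa.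
Proof. by move=> oo; rewrite /damping ecosDodd//; field. Qed.

(** Induction on J, pairing m with m + 2^(J+1), which adds an odd multiple of
    2^(s + J) to c b^m.  This moves the arguments of the old factors by integers
    and that of the new factor by half an odd integer; the two values of the new
    factor add up to 2 - kappa. *)
Lemma sum_damping_orbit (kappa : R) b s c J :
  (forall J, exists2 o, odd o & (b ^ (2 ^ J.+1) = 1 + 2 ^ (s + J) * o)%N) ->
  odd c -> odd b ->
  \sum_(m < 2 ^ J.+1) \prod_(i < J) damping kappa ((c * b ^ m)%:R / 2 ^+ (s + i.+1))
  = 2 * (2 - kappa) ^+ J.
Proof.
move=> Hb oc ob; elim: J => [|J IH].
  under eq_bigr do rewrite big_ord0.
  by rewrite sumr_const card_ord expr0 mulr1.
have [ o oo Eo] := Hb J.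
rewrite exprSr mulrA -IH mulr_suml.
have -> : (2 ^ J.+2 = 2 ^ J.+1 + 2 ^ J.+1)%N by rewrite expnS mul2n -addnn.
rewrite big_split_ord /= -big_split; apply: eq_bigr => m _.
rewrite !big_ord_recr /=.
have E i : (c * b ^ (2 ^ J.+1 + m))%:R / 2 ^+ (s + i.+1) =
    (c * b ^ m)%:R / 2 ^+ (s + i.+1) +
    (c * b ^ m * o)%:R * 2 ^+ (s + J) / 2 ^+ (s + i.+1) :> R.
  rewrite -mulrDl; congr (_ / _).
  by rewrite expnD Eo -natrX -natrM -natrD; congr (_%:R); lia.
have -> : \prod_(i < J) damping kappa ((c * b ^ (2 ^ J.+1 + m))%:R / 2 ^+ (s + i.+1))
    = \prod_(i < J) damping kappa ((c * b ^ m)%:R / 2 ^+ (s + i.+1)).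
  apply: eq_bigr => i _; rewrite E.
  have -> : (c * b ^ m * o)%:R * 2 ^+ (s + J) / 2 ^+ (s + i.+1) =
     (c * b ^ m * o * 2 ^ (J - i.+1))%:R :> R.
    rewrite [RHS]natrM natrX -mulrA; congr (_ * _).
    have -> : (s + J = s + i.+1 + (J - i.+1))%N by have := ltn_ord i; lia.
    by rewrite exprD mulrC mulKf// expf_neq0.
  by rewrite dampingDn.
rewrite -mulrDr E; congr (_ * _).
have -> : (c * b ^ m * o)%:R * 2 ^+ (s + J) / 2 ^+ (s + J.+1) =
    (c * b ^ m * o)%:R / 2 :> R.
  by rewrite addnS exprSr invfM mulrA mulfK// expf_neq0.
by rewrite dampingDodd// !oddM oc oo oddX ob orbT.
Qed.

End orbit_of_odd_base.

(** * Second moments for bases that are not powers of two *)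

Section correlation_sums.
Context {R : realType}.
Context (phi : nat -> R).
Context (phi01 : forall n, (1 <= n)%N -> 0 < phi n < 1).
Context (phi_mono : forall m n, (1 <= m)%N -> (m <= n)%N -> phi n <= phi m).

Lemma bit_factor01 n u : (1 <= n)%N -> 0 <= bit_factor phi n u <= 1.
Proof.
move=> /phi01 /andP[p0 p1]; rewrite /bit_factor.
have := ecos_le1 u; rewrite ler_norml => /andP[c0 c1].
have q0 : 0 <= 1 - phi n ^+ 2 by nra.
have := mulr_ge0 q0 (_ : 0 <= 1 - ecos u); have := mulr_ge0 q0 (_ : 0 <= 1 + ecos u).
rewrite !subr_ge0 -lerBlDl sub0r => /(_ c0) A /(_ c1) B; apply/andP; split; nra.
Qed.

Lemma bit_factor_damping n u : (1 <= n)%N ->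
  bit_factor phi n u <= damping (1 - phi 1 ^+ 2) u.
Proof.
move=> n1; have /andP[p0 p1] := phi01 n1; rewrite /bit_factor /damping.
have pm := phi_mono (leqnn 1) n1.
have : phi n ^+ 2 <= phi 1 ^+ 2 by rewrite ler_sqr// nnegrE; lra.
have := ecos_le1 u; rewrite ler_norml => /andP[_ c1] pp.
have := mulr_ge0 (_ : 0 <= phi 1 ^+ 2 - phi n ^+ 2) (_ : 0 <= 1 - ecos u).
rewrite !subr_ge0 => /(_ pp c1); lra.
Qed.

Lemma prod_window (w : nat -> R) a J N :
  (forall j, 0 <= w j <= 1) -> (a + J <= N)%N ->
  \prod_(j < N) w j <= \prod_(i < J) w (a + i)%N.
Proof.
move=> w01 /subnKC <-; rewrite !big_split_ord /=.
have p01 I (r : seq I) F : (forall i, 0 <= F i <= 1) ->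
    0 <= \prod_(i <- r) F i <= (1 : R).
  move=> F01; apply/andP; split; last by apply: prodr_ile1.
  by apply: prodr_ge0 => i _; case/andP: (F01 i).
have /andP[x0 x1] := p01 _ (index_enum 'I_a) (fun i => w i) (fun i => w01 i).
have /andP[y0 y1] := p01 _ (index_enum 'I_J) (fun i => w (a + i)%N)
   (fun i => w01 (a + i)%N).
have /andP[z0 z1] := p01 _ (index_enum 'I_(N - (a + J)))
   (fun i => w (a + J + i)%N) (fun i => w01 (a + J + i)%N).
by apply: le_trans (ler_piMr _ z1) _; [exact: mulr_ge0|exact: ler_piMl].
Qed.

(** The factors at the digits up to the 2-adic valuation of the frequency plus s
    are bounded by 1; the next J of them only depend on the odd part of the
    frequency, which is an odd constant times b'^m, and are controlled by
    [sum_damping_orbit].  The lower bound on N leaves room for these J digits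
    for all m at once. *)
Lemma fourier_decay_orbit a b' s : odd b' ->
  (forall J, exists2 o, odd o & (b' ^ (2 ^ J.+1) = 1 + 2 ^ (s + J) * o)%N) ->
  forall h d K J N, (0 < h)%N -> (0 < d < K)%N -> (K <= 2 ^ J.+1)%N ->
  (1 < 2 ^ a * b')%N ->
  (h * (2 ^ a * b') ^ K + a * K + s + J <= N)%N ->
  \sum_(m < K)
    bitE phi 0 N (fun x =>
      ecos ((h * ((2 ^ a * b') ^ d - 1) * (2 ^ a * b') ^ m)%:R * x)) ^+ 2
  <= 2 * (1 + phi 1 ^+ 2) ^+ J.
Proof.
move=> ob' Hs h d K J N h0 /andP[d0 dK] KJ b1 NK.
set b := (2 ^ a * b')%N in b1 NK *.
have bd1 : (1 < b ^ d)%N by rewrite -(exp1n d) ltn_exp2r.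
have T0 : (0 < h * (b ^ d - 1))%N by rewrite muln_gt0 h0 subn_gt0.
have [ o /[!coprime2n] oo Eo] := pfactor_coprime (isT : prime 2) T0.
set v := logn 2 _ in Eo; rewrite Eo.
have vle : (v <= h * b ^ K)%N.
  apply: leq_trans (_ : h * (b ^ d - 1) <= _)%N.
    by apply: ltnW; apply: ltn_logl.
  rewrite leq_mul2l; apply/orP; right; apply: leq_trans (leq_subr _ _) _.
  by rewrite leq_exp2l// ltnW.
have k1 : 1 + phi 1 ^+ 2 = 2 - (1 - phi 1 ^+ 2) by ring.
rewrite k1 -(@sum_damping_orbit R (1 - phi 1 ^+ 2) b' s o J Hs oo ob').
rewrite (big_ord_widen (2 ^ J.+1) (fun m => bitE phi 0 N (fun x =>
      ecos ((o * 2 ^ v * b ^ m)%:R * x)) ^+ 2) KJ).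
rewrite big_mkcond /=; apply: ler_sum => m _.
have p1 := phi01 (leqnn 1).
have dmp u : 0 <= damping (1 - phi 1 ^+ 2) u.
  exact: le_trans (proj1 (andP (bit_factor01 u (leqnn 1)))) (bit_factor_damping u _).
case: ifP => mK; last by apply: prodr_ge0.
apply: le_trans (_ : \prod_(j < N) bit_factor phi (0 + j.+1)
    ((o * 2 ^ v * b ^ m)%:R / 2 ^+ (0 + j.+1)) <= _).
  by rewrite -bitE_fourier lerDl sqr_ge0.
apply: le_trans (@prod_window (fun j => bit_factor phi j.+1
    ((o * 2 ^ v * b ^ m)%:R / 2 ^+ j.+1)) (v + a * m + s) J N _ _) _.
- by move=> j; apply: bit_factor01.
- by apply: leq_trans NK; rewrite leq_add2r leq_add2r leq_add// leq_mul2l ltnW ?orbT.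
apply: ler_prod => i _; have /andP[-> _] := @bit_factor01 (v + a * m + s + i).+1
  ((o * 2 ^ v * b ^ m)%:R / 2 ^+ (v + a * m + s + i).+1) isT.
apply: le_trans (bit_factor_damping _ _) _ => //.
rewrite le_eqVlt; apply/orP; left; apply/eqP; congr (damping _ _).
rewrite /b expnMn -expnM -addnS -addnA exprD exprD.
rewrite (_ : (o * 2 ^ v * (2 ^ (a * m) * b' ^ m))%:R =
   2 ^+ v * 2 ^+ (a * m) * (o * b' ^ m)%:R :> R); last by rewrite !natrM !natrX; ring.
by rewrite [in LHS]invfM mulrACA mulfV ?mul1r// mulf_neq0// expf_neq0.
Qed.

Lemma sum_pairs_le (A B : nat -> nat -> R) K :
  (forall n m, A n m = A m n) ->
  (forall d m, (m + d < K)%N -> A (m + d)%N m <= B d m) ->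
  (forall d m, 0 <= B d m) ->
  \sum_(n < K) \sum_(m < K) A n m <= 2 * \sum_(d < K) \sum_(m < K) B d m.
Proof.
move=> Asym AB B0.
have S1 : \sum_(n < K) \sum_(m < K) A n m <=
    \sum_(n < K) \sum_(m < K) ((if (m <= n)%N then B (n - m)%N m else 0)
                             + (if (n <= m)%N then B (m - n)%N n else 0)).
  apply: ler_sum => n _; apply: ler_sum => m _.
  have [mn|nm] := leqP m n.
    apply: ler_wpDr; first by case: ifP.
    by rewrite -{1}(subnKC mn); apply: AB; rewrite subnKC.
  rewrite (ltnW nm) add0r Asym -{1}(subnKC (ltnW nm)); apply: AB.
  by rewrite subnKC// ltnW.
apply: le_trans S1 _.
under eq_bigr do rewrite big_split.
rewrite big_split /= [X in _ + X]exchange_big /= -mulr2n -[leLHS]mulr_natl.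
rewrite ler_pM2l//.
apply: le_trans (_ : \sum_(n < K) \sum_(m < K)
   \sum_(d < K) 
   (if d == (n - m)%N :> nat then (if (m <= n)%N then B d m else 0) else 0) <= _).
  apply: ler_sum => n _; apply: ler_sum => m _.
  have nm : (n - m < K)%N by apply: leq_ltn_trans (leq_subr _ _) (ltn_ord n).
  rewrite (bigD1 (Ordinal nm))//= eqxx ler_wpDr// sumr_ge0// => d _.
  by case: ifP => // _; case: ifP.
rewrite exchange_big /= [leRHS]exchange_big /=; apply: ler_sum => m _.
rewrite exchange_big /=; apply: ler_sum => d _.
have [dm|dm] := ltnP (m + d) K; last first.
  rewrite big1// => n _; case: eqP => // E; case: ifP => // mn.
  by move: dm; rewrite E subnKC// leqNgt ltn_ord.
rewrite (bigD1 (Ordinal dm))//= big1 ?addr0; last first.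
  move=> n /eqP nE; case: eqP => // E; case: ifP => // mn.
  by exfalso; apply: nE; apply/val_inj => /=; rewrite E subnKC.
by rewrite addnC addnK eqxx leq_addl.
Qed.

Lemma sq_sum_ecos_esin (t : nat -> R) K x :
  (\sum_(n < K) ecos (t n * x)) ^+ 2 + (\sum_(n < K) esin (t n * x)) ^+ 2
  = \sum_(n < K) \sum_(m < K) ecos ((t n - t m) * x).
Proof.
rewrite !expr2 !mulr_suml -big_split; apply: eq_bigr => n _.
rewrite !mulr_sumr -big_split; apply: eq_bigr => m _.
by rewrite mulrBl ecosB.
Qed.

(** Expanding the square gives Fourier coefficients E of size bounded only in
    mean square; the inequality 2 E <= rho^J + E^2 / rho^J turns this into a
    bound on their sum.  The choice rho = 1 - kappa / 4 ensures
    1 - kappa / 2 <= rho^2, so both terms contribute about K rho^J. *)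
Lemma second_moment_orbit a b' h :
  odd b' -> (3 <= b')%N -> (0 < h)%N ->
  exists2 rho, 0 < rho < 1 & forall K, (0 < K)%N ->
    exists N0, forall N, (N0 <= N)%N ->
    bitE phi 0 N (fun x =>
      (\sum_(n < K) ecos ((h * (2 ^ a * b') ^ n)%:R * x)) ^+ 2 +
      (\sum_(n < K) esin ((h * (2 ^ a * b') ^ n)%:R * x)) ^+ 2)
    <= 5 * K%:R ^+ 2 * rho ^+ (trunc_log 2 K).
Proof.
move=> ob' b3 h0; have [s Hs] := odd_pow_two_power ob' b3.
set b := (2 ^ a * b')%N.
have b1 : (1 < b)%N.
  by apply: leq_trans (_ : 1 * b' <= _)%N; rewrite ?leq_mul2r ?expn_gt0 ?orbT ?mul1n// ltnW.
have /andP[p0 p1] := phi01 (leqnn 1).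
set kappa := 1 - phi 1 ^+ 2.
have k01 : 0 < kappa < 1 by rewrite /kappa; nra.
pose rho := 1 - kappa / 4.
have r01 : 3 / 4 < rho < 1 by rewrite /rho; lra.
exists rho => [|K K0]; first by lra.
set J := trunc_log 2 K.
have KJ : (K < 2 ^ J.+1)%N by exact: trunc_log_ltn.
have JK : (2 ^ J <= K)%N by exact: trunc_logP.
exists (h * b ^ K + a * K + s + J)%N => N NN.
under eq_fun do rewrite (sq_sum_ecos_esin (fun n => (h * b ^ n)%:R)).
rewrite bitE_sum; under eq_bigr do rewrite bitE_sum.
have rJ : 0 < rho ^+ J by apply: exprn_gt0; lra.
set E := fun d m => bitE phi 0 N (fun x => ecos ((h * (b ^ d - 1) * b ^ m)%:R * x)).
(* The diagonal d = 0 is bounded by 1; elsewhere twice this bound minus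
   2 E is a square divided by rho ^+ J. *)
pose B d m := if d is 0%N then 1 else (rho ^+ J + E d m ^+ 2 / rho ^+ J) / 2.
have B0 d m : 0 <= B d m.
  by case: d => //= d; rewrite divr_ge0// addr_ge0 ?divr_ge0 ?sqr_ge0// ltW.
apply: le_trans (@sum_pairs_le (fun n m => bitE phi 0 N
   (fun x => ecos (((h * b ^ n)%:R - (h * b ^ m)%:R) * x))) B K _ _ B0) _.
- move=> n m; apply: bitE_ext => x.
  by rewrite -ecosN -mulNr opprB.
- move=> [|d] m mdK /=.
    rewrite addn0 subrr -[leRHS](@bitE_cst R phi 0 N).
    by apply: bitE_le => // i _; rewrite mul0r ecos0.
  have -> : bitE phi 0 N (fun x =>
      ecos (((h * b ^ (m + d.+1))%:R - (h * b ^ m)%:R) * x)) = E d.+1 m.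
    apply: bitE_ext => x; congr (ecos (_ * x)).
    rewrite -natrB; last by rewrite leq_mul2l leq_exp2l// leq_addr orbT.
    by congr (_%:R); rewrite expnD -mulnBr -mulnA mulnBl mul1n mulnC (mulnC _ (b ^ m)%N) mulnC.
  rewrite ler_pdivlMr// -subr_ge0.
  have -> : rho ^+ J + E d.+1 m ^+ 2 / rho ^+ J - E d.+1 m * 2 =
     (rho ^+ J - E d.+1 m) ^+ 2 / rho ^+ J by field; rewrite gt_eqF.
  by rewrite divr_ge0 ?sqr_ge0// ltW.
have K0' : 0 < K%:R :> R by rewrite ltr0n.
(* Since 2 rho >= 1, the diagonal is also absorbed by K^2 rho^J. *)
have J2 : 1 <= K%:R * rho ^+ J.
  apply: le_trans (_ : (2 * rho) ^+ J <= _); first by apply: exprn_ege1; lra.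
  by rewrite exprMn ler_pM2r// -natrX ler_nat.
have bnd d : (d < K)%N -> \sum_(m < K) B d m <=
    (if d == 0 then K%:R else 0) + 3 / 2 * K%:R * rho ^+ J.
  case: d => [|d] dK /=.
    rewrite sumr_const card_ord lerDl; do 2?[apply: mulr_ge0]; lra.
  rewrite add0r -mulr_suml big_split /= sumr_const card_ord -mulr_suml.
  have : \sum_(i < K) E d.+1 i ^+ 2 <= 2 * (1 + phi 1 ^+ 2) ^+ J.
    by apply: (@fourier_decay_orbit a b' s) => //; exact: ltnW.
  have : (1 + phi 1 ^+ 2) ^+ J <= K%:R * (rho ^+ J * rho ^+ J).
    apply: le_trans (_ : (2 * (rho * rho)) ^+ J <= _).
      have -> : 1 + phi 1 ^+ 2 = 2 - kappa by rewrite /kappa; ring.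
      by apply: lerXn2r; rewrite ?nnegrE /rho; have := sqr_ge0 kappa; nra.
    rewrite !exprMn ler_pM2r ?mulr_gt0// -natrX ler_nat//.
  move=> H1 H2.
  have H3 : (\sum_(i < K) E d.+1 i ^+ 2) / rho ^+ J <= 2 * K%:R * rho ^+ J.
    rewrite ler_pdivrMr//; nra.
  rewrite -mulr_natl; lra.
apply: le_trans (_ : 2 * \sum_(d < K)
    ((if d == 0%N :> nat then K%:R else 0) + 3 / 2 * K%:R * rho ^+ J) <= _).
  by rewrite ler_pM2l//; apply: ler_sum => d _; apply: bnd.
rewrite big_split /= sumr_const card_ord.
case: K K0 @J KJ JK rJ NN @E B B0 K0' J2 bnd => // K _ J _ _ rJ _ E B _ K0' J2 _.
rewrite big_ord_recl /= big1// addr0 -mulr_natl.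
nra.
Qed.

End correlation_sums.

(** * Variances for bases that are powers of two *)

Section power_of_two_base.
Context {R : realType}.
Context (phi : nat -> R).
Context (phi01 : forall n, (1 <= n)%N -> 0 < phi n < 1).

Section covariance.
Context (f : R -> R) (L : R) (a : nat).
Context (a0 : (0 < a)%N).
Context (f1 : forall x, `|f x| <= 1).
Context (fper : forall x n, f (x + n%:R) = f x).
Context (flip : forall x y, `|f x - f y| <= L * `|x - y|).

Lemma lip_ge0 : 0 <= L.
Proof. by have := le_trans (normr_ge0 _) (flip 1 0); rewrite subr0 normr1 mulr1. Qed.

Let F n x := f (((2 ^ a) ^ n)%:R * x).

(** Condition on the digits up to M = a (m + d).  Multiplied by 2^M, these give
    an integer, so F (m + d) only depends on the later digits; those move the
    argument of F m by at most 2^-(a d).  Both the expectation of the product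
    and the product of the expectations are thus within L / 2^d of U G, where U
    averages F (m + d) over the late digits and G averages F m over the early
    ones. *)
Lemma covariance_le m d N : (a * (m + d) <= N)%N ->
  `|bitE phi 0 N (fun x => F (m + d) x * F m x)
    - bitE phi 0 N (F (m + d)) * bitE phi 0 N (F m)| <= 2 * L / 2 ^+ d.
Proof.
set n := (m + d)%N; set M := (a * n)%N => /subnKC <-; set k := (N - M)%N.
rewrite !bitE_split.
have per z i : F n (i%:R / 2 ^+ (0 + M) + z) = F n z.
  rewrite /F mulrDr addrC add0n.
  have -> : ((2 ^ a) ^ n)%:R * (i%:R / 2 ^+ M) = i%:R :> R.
    by rewrite -expnM natrX mulrC divfK ?expf_neq0.
  exact: fper.
have -> : bitE phi M k (fun z => bitE phi 0 M (fun y => F n (y + z))) =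
    bitE phi M k (F n).
  apply: bitE_ext => z; rewrite -[RHS](@bitE_cst R phi 0 M).
  by apply: bitE_eq => // i _; rewrite per.
have -> : bitE phi M k (fun z => bitE phi 0 M (fun y => F n (y + z) * F m (y + z))) =
    bitE phi M k (fun z => F n z * bitE phi 0 M (fun y => F m (y + z))).
  apply: bitE_ext => z; rewrite -bitEZ.
  by apply: bitE_eq => // i _; rewrite per.
set eps := L / 2 ^+ d.
have eps0 : 0 <= eps by rewrite divr_ge0 ?lip_ge0 ?exprn_ge0.
set G := bitE phi 0 M (F m).
have Gz i : (i < 2 ^ k)%N ->
    `|bitE phi 0 M (fun y => F m (y + i%:R / 2 ^+ (M + k))) - G| <= eps.
  move=> ik; apply: bitE_dist => // j _.
  apply: le_trans (flip _ _) _; rewrite -mulrBr addrC addKr /eps ler_wpM2l ?lip_ge0//.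
  rewrite ger0_norm; last by rewrite mulr_ge0// divr_ge0// exprn_ge0.
  rewrite mulrA ler_pdivrMr ?exprn_gt0// ler_pdivlMl ?exprn_gt0//.
  rewrite -!natrX -!natrM ler_nat -expnM.
  have -> : (M + k = a * m + a * d + k)%N by rewrite /M /n mulnDr.
  rewrite expnD (addnC (a * m)%N) expnD mulnA.
  apply: leq_mul; first by rewrite leq_mul2r leq_exp2l// leq_pmull ?orbT.
  by rewrite ltnW.
have HF : `|bitE phi M k (F n)| <= 1.
  rewrite -[X in `|X|]subr0 -[X in _ - X](@bitE_cst R phi M k).
  by apply: bitE_dist => // i _; rewrite subr0; exact: f1.
set U := bitE phi M k (F n) in HF *.
set V := bitE phi M k (fun z => bitE phi 0 M _).
have VG : `|V - G| <= eps.
  by rewrite /V -[X in _ - X](@bitE_cst R phi M k); apply: bitE_dist.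
set W := bitE _ _ _ _.
have WG : `|W - G * U| <= eps.
  rewrite /W /U -bitEZ; apply: bitE_dist => // i ik.
  rewrite (mulrC G) -mulrBr normrM -[leRHS]mul1r.
  by apply: ler_pM => //; [exact: f1|exact: Gz].
have -> : 2 * L / 2 ^+ d = eps + eps by rewrite /eps; ring.
have -> : W - U * V = (W - G * U) - U * (V - G) by ring.
apply: le_trans (ler_normB _ _) _; apply: lerD => //.
by rewrite normrM -[leRHS]mul1r; exact: ler_pM.
Qed.

Lemma variance_le K N : (a * K <= N)%N ->
  bitE phi 0 N (fun x => (\sum_(n < K) F n x) ^+ 2)
    - (bitE phi 0 N (fun x => \sum_(n < K) F n x)) ^+ 2
  <= 4 * (1 + 2 * L) * K%:R.
Proof.
move=> KN; have L0 := lip_ge0.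
have -> : bitE phi 0 N (fun x => (\sum_(n < K) F n x) ^+ 2)
    - (bitE phi 0 N (fun x => \sum_(n < K) F n x)) ^+ 2 =
  \sum_(n < K) \sum_(m < K) (bitE phi 0 N (fun x => F n x * F m x)
    - bitE phi 0 N (F n) * bitE phi 0 N (F m)).
  rewrite bitE_sum expr2 mulr_suml.
  under [in RHS]eq_bigr do rewrite sumrB.
  rewrite sumrB; congr (_ - _); last by apply: eq_bigr => n _; rewrite mulr_sumr.
  under eq_bigr do rewrite -bitE_sum.
  rewrite -bitE_sum; apply: bitE_ext => x.
  by rewrite expr2 mulr_suml; apply: eq_bigr => n _; rewrite mulr_sumr.
apply: le_trans (@sum_pairs_le R (fun n m => bitE phi 0 N (fun x => F n x * F m x)
    - bitE phi 0 N (F n) * bitE phi 0 N (F m)) (fun d m => (1 + 2 * L) / 2 ^+ d) K _ _ _) _.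
- by move=> n m; rewrite mulrC; congr (_ - _); apply: bitE_ext => x; rewrite mulrC.
- move=> [|d] m mdK.
    rewrite addn0 expr0 divr1; apply: le_trans (_ : 1 <= _); last by lra.
    rewrite -[leRHS](@bitE_cst R phi 0 N).
    apply: le_trans (_ : bitE phi 0 N (fun x => F m x * F m x) <= _).
      by rewrite gerBl -expr2 sqr_ge0.
    apply: bitE_le => // i _; rewrite /F.
    by have := f1 (((2 ^ a) ^ m)%:R * (i%:R / 2 ^+ (0 + N))); rewrite ler_norml; nra.
  apply: le_trans (ler_norm _) _; apply: le_trans (covariance_le _) _.
    by apply: leq_trans KN; rewrite leq_mul2l ltnW ?orbT.
  by rewrite ler_pM2r ?invr_gt0 ?exprn_gt0//; lra.
- by move=> d m; rewrite divr_ge0 ?exprn_ge0//; lra.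
under eq_bigr do rewrite sumr_const card_ord.
have geo : \sum_(d < K) (2 ^- d : R) <= 2.
  have -> : \sum_(d < K) (2 ^- d : R) = 2 - 2 * 2 ^- K.
    elim: K {KN} => [|K IH]; first by rewrite big_ord0 expr0 invr1 mulr1 subrr.
    rewrite big_ord_recr /= IH exprS invfM mulrA mulfV ?pnatr_eq0//; ring.
  by rewrite gerBl mulr_ge0// invr_ge0 exprn_ge0.
rewrite sumrMnl -mulr_sumr -[X in 2 * X]mulr_natr.
have : 0 <= K%:R :> R by []. 
move: (\sum_(d < K) (2 ^- d : R)) geo => s geo K0.
have -> : 2 * ((1 + 2 * L) * s * K%:R) = (2 * (1 + 2 * L) * K%:R) * s by ring.
have -> : 4 * (1 + 2 * L) * K%:R = (2 * (1 + 2 * L) * K%:R) * 2 by ring.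
by apply: ler_wpM2l => //; rewrite !mulr_ge0//; lra.
Qed.

End covariance.

(** The digit whose position is one more than the 2-adic valuation of the
    frequency sees an odd multiple of one half, where [bit_factor] collapses to
    phi^2. *)
Lemma mean_power_of_two a h n N : (0 < h)%N ->
  (a * n + logn 2 h < N)%N ->
  bitE phi 0 N (fun x => ecos ((h * (2 ^ a) ^ n)%:R * x)) ^+ 2 +
  bitE phi 0 N (fun x => esin ((h * (2 ^ a) ^ n)%:R * x)) ^+ 2
  <= phi (a * n + logn 2 h).+1 ^+ 2.
Proof.
move=> h0 nN; rewrite bitE_fourier.
have [ o /[!coprime2n] oo] := pfactor_coprime (isT : prime 2) h0.
set v := logn 2 h in nN *; move=> ->.
apply: le_trans (@prod_window R (fun j => bit_factor phi j.+1
    ((o * 2 ^ v * (2 ^ a) ^ n)%:R / 2 ^+ j.+1)) (a * n + v) 1 N _ _) _.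
- by move=> j; apply: bit_factor01.
- by rewrite addn1.
rewrite big_ord_recl big_ord0 mulr1 addn0 /=.
have -> : (o * 2 ^ v * (2 ^ a) ^ n)%:R / 2 ^+ (a * n + v).+1 = 0 + o%:R / 2 :> R.
  rewrite add0r -mulnA natrM -expnM -expnD natrX addnC.
  by rewrite exprS invfM -!mulrA (mulrC (2^-1)) mulVKf// expf_neq0.
by rewrite /bit_factor ecosDodd// ecos0; lra.
Qed.

End power_of_two_base.

(** * From finite convolutions to the weak limit *)

Section integral_of_convolutions.
Context {R : realType}.
Context (phi : nat -> R).
Context (phi01 : forall n, (1 <= n)%N -> 0 < phi n < 1).
Context (nu : nat -> probability R R).
Context (nuE : forall n, (1 <= n)%N -> forall A : set R,
       measurable A ->
       nu n A = ((2^-1 * (1 + phi n))%:E * \d_(0%R : R) A +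
                 (2^-1 * (1 - phi n))%:E * \d_(2%R ^- n : R)%R A)%E).

Lemma integral_digit_law n (f : R -> R) : (1 <= n)%N ->
  measurable_fun setT f -> (forall x, 0 <= f x) ->
  (\int[nu n]_x (f x)%:E = (2^-1 * (1 + phi n) * f 0 +
     2^-1 * (1 - phi n) * f (2 ^- n))%:E)%E.
Proof.
move=> n1 mf f0; have /andP[p0 p1] := phi01 n1.
have q0 : 0 <= 2^-1 * (1 + phi n) by lra.
have q1 : 0 <= 2^-1 * (1 - phi n) by lra.
have mfE : measurable_fun [set: R] (EFin \o f) by exact/measurable_EFinP.
rewrite (@eq_measure_integral _ _ _ _ (measure_add (mscale (NngNum q0) \d_(0 : R))
   (mscale (NngNum q1) \d_(2%R ^- n : R)))); last first.
  move=> A mA _; etransitivity; first exact: (nuE n1 mA).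
  exact/esym/measure_addE.
rewrite ge0_integral_measure_add//.
  rewrite !ge0_integral_mscale//; try by move=> x _; rewrite lee_fin.
  by rewrite !integral_dirac// !diracT !mul1e.
by move=> x _; rewrite lee_fin.
Qed.

Lemma integral_partial_convolution n (f : R -> R) :
  measurable_fun setT f -> (forall x, 0 <= f x) ->
  (\int[partial_convolution nu n]_x (f x)%:E = (bitE phi 0 n f)%:E)%E.
Proof.
elim: n f => [|n IH] f mf f0.
  rewrite /= integral_dirac//; last exact/measurable_EFinP.
  by rewrite diracT mul1e.
rewrite /= /convolution.
have mfE : measurable_fun [set: R] (EFin \o f) by exact/measurable_EFinP.
rewrite ge0_integral_distribution//.
rewrite fubini_tonelli1//=; last first.
- by move=> z; rewrite lee_fin.
- apply: measurableT_comp => //; exact: measurable_sum_pair.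
rewrite /fubini_F /=.
have mfs c : measurable_fun setT (fun x : R => f (x + c)).
  by apply: measurableT_comp => //; exact: measurable_funD.
have mfs' c : measurable_fun setT (fun x : R => f (c + x)).
  by apply: measurableT_comp => //; exact: measurable_funD.
have /andP[p0 p1] := phi01 (ltn0Sn n).
set c0 := 2^-1 * (1 + _); set c1 := 2^-1 * (1 - _).
have c00 : 0 <= c0 by rewrite /c0 add0n; lra.
have c10 : 0 <= c1 by rewrite /c1 add0n; lra.
rewrite (eq_integral (fun x =>
    (c0%:E * (f x)%:E + c1%:E * (f (x + 2 ^- n.+1))%:E)%E)); last first.
  move=> x _; transitivity (\int[nu n.+1]_y (f (x + y))%:E)%E => //.
  by rewrite (integral_digit_law _ (mfs' x))// addr0.
have mE (g : R -> R) : measurable_fun [set: R] g ->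
    measurable_fun [set: R] (fun x => (g x)%:E) by move=> mg; exact/measurable_EFinP.
have mcE (c : R) (g : R -> R) : measurable_fun [set: R] g ->
    measurable_fun [set: R] (fun x => c%:E * (g x)%:E)%E.
  by move=> mg; apply: emeasurable_funM; [exact: measurable_cst|exact: mE].
rewrite ge0_integralD//; first last.
- exact: (mcE _ _ (mfs _)).
- by move=> x _; rewrite -EFinM lee_fin mulr_ge0.
- exact: (mcE _ _ mf).
- by move=> x _; rewrite -EFinM lee_fin mulr_ge0.
rewrite !ge0_integralZl//; try by [move=> x _; rewrite lee_fin | exact: (mE _ (mfs _))].
by rewrite !IH// -!EFinM -EFinD.
Qed.

Context (mu : probability R R).
Context (mu_conv : is_infinite_convolution nu mu).

Lemma continuous_bounded_integrable (f : R -> R) C :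
  continuous f -> (forall x, `|f x| <= C) -> mu.-integrable setT (EFin \o f).
Proof.
move=> cf fC; apply: (@le_integrable _ _ _ mu setT _ _ (cst C%:E)) => //.
- by apply/measurable_EFinP; exact: continuous_measurable_fun.
- move=> x _ /=; rewrite lee_fin; apply: le_trans (fC x) _; exact: ler_norm.
- exact: finite_measure_integrable_cst.
Qed.

(** Adding the bound C makes f nonnegative, so that the integrals against the
    partial convolutions can be computed by Tonelli's theorem. *)
Lemma bitE_cvg_integral (f : R -> R) C :
  continuous f -> (forall x, `|f x| <= C) ->
  bitE phi 0 N f @[N --> \oo] --> \int[mu]_x f x.
Proof.
move=> cf fC; have If := continuous_bounded_integrable cf fC.
pose g x := f x + C.
have cg : continuous g by move=> x; apply: cvgD; [exact: cf|exact: cvg_cst].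
have g0 x : 0 <= g x by have := fC x; rewrite ler_norml => /andP[]; rewrite /g; lra.
have bg : bounded_fun g.
  exists (2 * C); split; first exact: num_real.
  move=> M CM x _ /=; rewrite ger0_norm// ltW//; apply: le_lt_trans CM.
  by have := fC x; rewrite ler_norml => /andP[]; rewrite /g; lra.
have := mu_conv cg bg.
have -> : (fun N => \int[partial_convolution nu N]_x (g x)%:E)%E =
    (fun N => (bitE phi 0 N g)%:E).
  apply/funext => N; apply: integral_partial_convolution => //.
  exact: continuous_measurable_fun.
have -> : (\int[mu]_x (g x)%:E = (\int[mu]_x f x + C)%:E)%E.
  have -> : (\int[mu]_x (g x)%:E = \int[mu]_x ((f x)%:E + C%:E))%E by [].
  rewrite integralD//; last exact: finite_measure_integrable_cst.
  rewrite integral_cst//= [mu setT]probability_setT mule1 EFinD fineK//.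
  exact: integrable_fin_num.
move=> /fine_cvgP[_] /=.
have E : fine \o (fun N => (bitE phi 0 N g)%:E) = (fun N => bitE phi 0 N f + C).
  by apply/funext => N /=; rewrite bitED bitE_cst.
rewrite E => H.
have -> : (fun N => bitE phi 0 N f) = (fun N => (bitE phi 0 N f + C) - C).
  by apply/funext => N; rewrite addrK.
by rewrite -[X in _ --> X](addrK C); apply: cvgB => //; exact: cvg_cst.
Qed.

Lemma integral_le_of_bitE (f : R -> R) C D :
  continuous f -> (forall x, `|f x| <= C) ->
  (exists N0, forall N, (N0 <= N)%N -> bitE phi 0 N f <= D) ->
  \int[mu]_x f x <= D.
Proof.
move=> cf fC [N0 H]; have H1 := bitE_cvg_integral cf fC.
rewrite -(cvg_lim _ H1)//; apply: limr_le; first by apply/cvg_ex; eexists; exact: H1.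
by exists N0.
Qed.

(** The test function 1 - 1 / (|x| + |x - 1|) is bounded, continuous, nonnegative
    and vanishes exactly on [0, 1], which carries all partial convolutions. *)
Lemma ae_in_unit_interval : {ae mu, forall x, 0 <= x <= 1}.
Proof.
pose f (x : R) := 1 - (`|x| + `|x - 1|)^-1.
have g1 (x : R) : 1 <= `|x| + `|x - 1|.
  by rewrite -[leLHS]normr1 -[in leLHS](subKr x 1); exact: ler_normB.
have f0 x : 0 <= f x by rewrite /f subr_ge0 invf_le1 ?(lt_le_trans ltr01 (g1 x)).
have cf : continuous f.
  move=> x; apply: cvgB; first exact: cvg_cst.
  apply: cvgV; first by rewrite gt_eqF// (lt_le_trans ltr01 (g1 x)).
  apply: cvgD; apply: cvg_norm; first exact: cvg_id.
  by apply: cvgB; [exact: cvg_id|exact: cvg_cst].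
have f1 x : `|f x| <= 1.
  by rewrite ger0_norm// /f gerBl invr_ge0 (le_trans ler01 (g1 x)).
have fz x : f x = 0 -> 0 <= x <= 1.
  move/eqP; rewrite /f subr_eq0 eq_sym invr_eq1 => /eqP.
  have [x0|x0] := leP 0 x; have [x1|x1] := leP 0 (x - 1).
  - by rewrite !ger0_norm//; lra.
  - by rewrite ger0_norm// ltr0_norm//; lra.
  - by rewrite ltr0_norm// ger0_norm//; lra.
  - by rewrite !ltr0_norm//; lra.
have If : \int[mu]_x f x <= 0.
  apply: (integral_le_of_bitE cf f1); exists 0%N => N _.
  rewrite -[leRHS](@bitE_cst R phi 0 N); apply: bitE_le => // i iN.
  set z := i%:R / _.
  have z0 : 0 <= z by rewrite divr_ge0// exprn_ge0.
  have z1 : z <= 1.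
    by rewrite ler_pdivrMr ?exprn_gt0// mul1r add0n -natrX ler_nat ltnW.
  have zz : `|z| + `|z - 1| = 1.
    by rewrite ger0_norm// ler0_norm ?subr_le0// opprB addrC subrK.
  by rewrite /f zz invr1 subrr.
have : (\int[mu]_x `|(f x)%:E| = 0)%E.
  under eq_integral do rewrite gee0_abs ?lee_fin//.
  rewrite -[LHS]fineK; last first.
    by apply: integrable_fin_num => //; exact: continuous_bounded_integrable f1.
  congr _%:E; apply/le_anti/andP; split; first exact: If.
  by apply: fine_ge0; apply: integral_ge0 => x _; rewrite lee_fin.
have mf : measurable_fun [set: R] (EFin \o f).
  by apply/measurable_EFinP; exact: continuous_measurable_fun.
move/(ae_eq_integral_abs mu measurableT mf); apply: filterS => x /= /(_ I) [].
exact: fz.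
Qed.

End integral_of_convolutions.

(** * Almost sure convergence from second moments *)

Section strong_law.
Context {R : realType}.

(** The sum of the Z k has finite integral, hence is finite almost everywhere. *)
Lemma ae_cvg0_of_summable_integrals d (T : measurableType d)
    (mu : {measure set T -> \bar R}) (Z : nat -> T -> R) (c : nat -> R) (M : R) :
  (forall k, measurable_fun [set: T] (Z k)) -> (forall k x, 0 <= Z k x) ->
  (forall k, \int[mu]_x (Z k x)%:E <= (c k)%:E)%E ->
  (forall n, \sum_(k < n) c k <= M) ->
  {ae mu, forall x, Z k x @[k --> \oo] --> 0}.
Proof.
move=> mZ Z0 Zc cM.
have mZE k : measurable_fun [set: T] (fun x => (Z k x)%:E) by exact/measurable_EFinP.
have Z0E k x : (0 <= (Z k x)%:E)%E by rewrite lee_fin.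
pose S x := (\sum_(0 <= k <oo) (Z k x)%:E)%E.
have S0 x : (0 <= S x)%E by apply: nneseries_ge0.
have mS : measurable_fun [set: T] S by exact: ge0_emeasurable_sum.
have IS : (\int[mu]_x S x < +oo)%E.
  rewrite /S integral_nneseries//.
  apply: le_lt_trans (ltry M); apply: lime_le.
    by apply: is_cvg_nneseries => n _ _; exact: integral_ge0.
  apply: nearW => n; rewrite big_mkord.
  apply: le_trans (_ : (\sum_(k < n) (c k)%:E <= _)%E); first exact: lee_sum.
  by rewrite sumEFin lee_fin.
have : mu.-integrable setT S.
  by apply/integrableP; split => //; under eq_integral do rewrite gee0_abs//.
move=> /(integrable_ae measurableT); apply: filterS => x /(_ I) Sfin.
apply: cvg_series_cvg_0; apply: nondecreasing_is_cvgn.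
  by apply/nondecreasing_seqP => n; rewrite /series /= big_nat_recr//= lerDl.
exists (fine (S x)) => _ [n _ <-].
rewrite -lee_fin fineK// -sumEFin.
exact: nneseries_lim_ge.
Qed.

(** Between k^r and (k + 1)^r the sum changes by at most B times the gap, which
    is negligible compared with k^r. *)
Lemma cvg_mean_of_power_subsequence (u : nat -> R) (B : R) r :
  (forall n, `|u n| <= B) -> (0 < r)%N ->
  (\sum_(n < k.+1 ^ r) u n) / (k.+1 ^ r)%:R @[k --> \oo] --> 0 ->
  (\sum_(n < N) u n) / N%:R @[N --> \oo] --> 0.
Proof.
move=> uB r0 H.
have B0 : 0 <= B by exact: le_trans (uB 0%N).
(* Bounds the mean at every N between (k + 1)^r and (k + 2)^r. *)
pose e k : R := `|(\sum_(n < k.+1 ^ r) u n) / (k.+1 ^ r)%:R|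
          + B * ((1 + k.+1%:R^-1) ^+ r - 1).
have h1 : (1 + k.+1%:R^-1 : R) @[k --> \oo] --> (1 : R).
  rewrite -[X in _ --> X](addr0 1).
  by apply: cvgD; [exact: cvg_cst|exact: cvg_harmonic].
have e0 : e k @[k --> \oo] --> 0.
  rewrite -[X in _ --> X](addr0 0); apply: cvgD; first exact/norm_cvg0P.
  rewrite -[X in _ --> X](mulr0 B); apply: cvgM; first exact: cvg_cst.
  rewrite -[X in _ --> X](subrr 1); apply: cvgB; last exact: cvg_cst.
  rewrite -[X in _ --> X](expr1n R r).
  exact: (continuous_cvg _ (@exprn_continuous R r 1) h1).
apply/cvgr0Pnorm_lt => eps eps0.
have [k0 _ Hk0] : \forall k \near \oo, `|e k| < eps.
  by move/cvgr0Pnorm_lt : e0 => /(_ _ eps0).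
exists (k0.+1 ^ r)%N => // N /= kN.
have N0 : (0 < N)%N by apply: leq_trans kN; rewrite expn_gt0.
have ex : exists k, (k.+1 ^ r <= N)%N by exists k0.
have bd k : (k.+1 ^ r <= N)%N -> (k <= N)%N.
  by apply: leq_trans; apply/(leq_trans (leqnSn k))/(@leq_pexp2l k.+1 1 r).
have [k kr kmax] := ex_maxnP ex bd.
have k0k : (k0 <= k)%N by exact: kmax.
have kN2 : (N < k.+2 ^ r)%N by rewrite ltnNge; apply/negP => /kmax; rewrite ltnn.
apply: le_lt_trans (Hk0 k k0k); apply: le_trans (ler_norm _).
rewrite /e normrM normfV [`|_%:R|]ger0_norm//.
have kp : 0 < (k.+1 ^ r)%:R :> R by rewrite ltr0n expn_gt0.
have Np : 0 < N%:R :> R by rewrite ltr0n.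
rewrite ler_pdivrMr//.
have -> : \sum_(n < N) u n = \sum_(n < k.+1 ^ r) u n
    + \sum_(n < N - k.+1 ^ r) u (k.+1 ^ r + n)%N.
  by rewrite -[in LHS](subnKC kr) big_split_ord.
apply: le_trans (ler_normD _ _) _; rewrite mulrDl; apply: lerD.
  rewrite normrM -mulrA ler_peMr// normfV [`|_%:R|]ger0_norm//.
  by rewrite -ler_pdivrMl ?invr_gt0// invrK mulr1 ler_nat.
apply: le_trans (_ : (N - k.+1 ^ r)%:R * B <= _).
  apply: le_trans (ler_norm_sum _ _ _) _.
  apply: le_trans (ler_sum _ (fun i _ => uB _)) _.
  by rewrite sumr_const card_ord mulr_natl.
rewrite mulrC -mulrA ler_wpM2l//.
have -> : 1 + k.+1%:R^-1 = k.+2%:R / k.+1%:R :> R.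
  by rewrite -[k.+2%:R]natr1 mulrDl mulfV ?mul1r.
apply: le_trans (_ : ((k.+2%:R / k.+1%:R) ^+ r - 1) * (k.+1 ^ r)%:R <= _); last first.
  rewrite ler_wpM2l ?ler_nat// subr_ge0 exprn_ege1// ler_pdivlMr ?mul1r ?ler_nat//.
rewrite mulrBl mul1r exprMn exprVn natrX divfK ?expf_neq0//.
by rewrite natrB// natrX lerB// -natrX ler_nat ltnW.
Qed.

(** Along K = (k + 1)^r with rho^r <= 1 / 4, the second moments of the means are
    at most a constant times (k + 1)^-2, which is summable. *)
Lemma ae_mean_cvg0 d (T : measurableType d) (mu : probability T R)
    (Y : nat -> T -> R) (B C rho : R) :
  (forall n, measurable_fun [set: T] (Y n)) -> (forall n x, `|Y n x| <= B) ->
  0 < rho < 1 ->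
  (forall K, (0 < K)%N -> \int[mu]_x ((\sum_(n < K) Y n x) ^+ 2)%:E <=
     (C * K%:R ^+ 2 * rho ^+ trunc_log 2 K)%:E)%E ->
  {ae mu, forall x, (\sum_(n < K) Y n x) / K%:R @[K --> \oo] --> 0}.
Proof.
move=> mY YB /andP[rho0 rho1] H.
have [r r0 rr] : exists2 r, (0 < r)%N & rho ^+ r <= 4^-1.
  have : rho ^+ n @[n --> \oo] --> 0 by apply: cvg_expr; rewrite gtr0_norm.
  move/cvgr0Pnorm_lt => /(_ 4^-1 _)[]// n _ Hn.
  exists n.+1 => //; have := Hn n.+1 (leqnSn n).
  by rewrite /= ger0_norm; [exact: ltW|exact/exprn_ge0/ltW].
have C0 : 0 <= C.
  have := H 1%N isT; rewrite trunc_log1 expr0 expr1n !mulr1 -lee_fin.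
  by apply: le_trans; apply: integral_ge0 => x _; rewrite lee_fin sqr_ge0.
pose Z k x := ((\sum_(n < k.+1 ^ r) Y n x) / (k.+1 ^ r)%:R) ^+ 2.
(* At least 4 C / (k + 1)^2, and telescoping. *)
pose c k : R := 8 * C * (k.+1%:R^-1 - k.+2%:R^-1).
have mS K : measurable_fun [set: T] (fun x => \sum_(n < K) Y n x).
  exact: measurable_sum.
have mZ k : measurable_fun [set: T] (Z k).
  by apply: measurable_funX; exact: measurable_funM.
have Z0 k x : 0 <= Z k x by exact: sqr_ge0.
have : {ae mu, forall x, Z k x @[k --> \oo] --> 0}.
  apply: (@ae_cvg0_of_summable_integrals _ _ _ Z c (8 * C)) => // [k|n].
    set K := (k.+1 ^ r)%N.
    have K0 : (0 < K)%N by rewrite expn_gt0.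
    have Kp : 0 < K%:R :> R by rewrite ltr0n.
    have K2p : 0 < K%:R ^+ 2 :> R by rewrite exprn_gt0.
    have -> : (\int[mu]_x (Z k x)%:E =
        (K%:R ^- 2)%:E * \int[mu]_x ((\sum_(n < K) Y n x) ^+ 2)%:E)%E.
      rewrite -ge0_integralZl//.
      - by apply: eq_integral => x _; rewrite /Z exprMn exprVn mulrC EFinM.
      - by apply/measurable_EFinP; exact: measurable_funX.
      - by move=> x _; rewrite lee_fin sqr_ge0.
    apply: le_trans (lee_wpmul2l _ (H _ K0)) _; first by rewrite lee_fin invr_ge0 ltW.
    rewrite -EFinM lee_fin mulrA mulrCA mulVf ?gt_eqF// mulr1.
    set t := trunc_log 2 k.+1.
    have tK : (t * r <= trunc_log 2 K)%N.
      by apply: trunc_log_max => //; rewrite expnM leq_exp2r// trunc_logP.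
    have t4 : rho ^+ trunc_log 2 K <= 4 ^- t.
      apply: le_trans (_ : rho ^+ (t * r) <= _).
        by apply: ler_wiXn2l => //; exact: ltW.
      rewrite mulnC exprM -exprVn; apply: lerXn2r => //.
      by rewrite nnegrE; exact/exprn_ge0/ltW.
      by rewrite nnegrE invr_ge0.
    have kt : k.+1%:R ^+ 2 <= 4 * 4 ^+ t :> R.
      rewrite -exprS (_ : 4 = 2 ^+ 2 :> R); last by ring.
      rewrite exprAC; apply: lerXn2r; rewrite ?nnegrE//.
      by rewrite -natrX ler_nat ltnW// trunc_log_ltn.
    have -> : c k = C * (8 / (k.+1%:R * k.+2%:R)).
      by rewrite /c; field; rewrite !gt_eqF ?ltr_wpDr.
    rewrite ler_wpM2l//; apply: le_trans t4 _.
    rewrite ler_pdivlMr ?mulr_gt0 ?ltr0n// mulrC ler_pdivrMr ?exprn_gt0//.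
    apply: le_trans (_ : 2 * k.+1%:R ^+ 2 <= _); last lra.
    have : 1 <= k.+1%:R :> R by rewrite ler1n.
    by rewrite -[k.+2%:R]natr1; nra.
  rewrite -mulr_sumr -[leRHS]mulr1 ler_wpM2l ?mulr_ge0//.
  have -> : \sum_(i < n) (i.+1%:R^-1 - i.+2%:R^-1) = 1 - n.+1%:R^-1 :> R.
    elim: n => [|n IH]; first by rewrite big_ord0 invr1 subrr.
    by rewrite big_ord_recr /= IH; ring.
  by rewrite gerBl invr_ge0.
apply: filterS => x Zx; apply: (@cvg_mean_of_power_subsequence (fun n => Y n x) B r) => //.
apply/cvgr0Pnorm_lt => eps eps0; move/cvgr0Pnorm_lt : Zx => /(_ (eps ^+ 2)).
rewrite exprn_gt0// => /(_ isT); apply: filterS => k.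
by rewrite /Z normrX ltr_pXn2r// nnegrE// ltW.
Qed.

End strong_law.

(** * Cesaro means *)

Section cesaro_means.
Context {R : realType}.
Implicit Types (f g : nat -> R) (c : R).

Definition mean f (N : nat) : R := (\sum_(i < N) f i) / N%:R.

Lemma mean_cst c N : (0 < N)%N -> mean (fun=> c) N = c.
Proof.
by move=> N0; rewrite /mean sumr_const card_ord -[c *+ N]mulr_natr mulfK// pnatr_eq0 -lt0n.
Qed.

Lemma meanD f g N : mean (fun i => f i + g i) N = mean f N + mean g N.
Proof. by rewrite /mean big_split /= mulrDl. Qed.

Lemma meanZ c f N : mean (fun i => c * f i) N = c * mean f N.
Proof. by rewrite /mean -mulr_sumr mulrA. Qed.

Lemma mean_sum I (r : seq I) (P : pred I) (F : I -> nat -> R) N :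
  mean (fun i => \sum_(k <- r | P k) F k i) N = \sum_(k <- r | P k) mean (F k) N.
Proof. by rewrite /mean exchange_big mulr_suml. Qed.

Lemma le_mean f g N : (forall i, f i <= g i) -> mean f N <= mean g N.
Proof. by move=> fg; rewrite /mean ler_wpM2r ?invr_ge0//; exact: ler_sum. Qed.

Lemma cvg_mean_cst c : mean (fun=> c) N @[N --> \oo] --> c.
Proof.
apply: cvg_near_cst; exists 1%N => // N /= N1; exact: mean_cst.
Qed.

Lemma cvg_mean_sum I (r : seq I) (P : pred I) (F : I -> nat -> R) (l : I -> R) :
  (forall k, P k -> mean (F k) N @[N --> \oo] --> l k) ->
  mean (fun i => \sum_(k <- r | P k) F k i) N @[N --> \oo] --> \sum_(k <- r | P k) l k.
Proof.
move=> H; under eq_fun do rewrite mean_sum.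
by apply: cvg_big => //; exact: add_continuous.
Qed.

End cesaro_means.

(** * The Fejer kernel and its averages over a grid *)

Section fejer_kernel.
Context {R : realType}.
Implicit Types (u x : R).

Lemma two_esin_ecos u x : 2 * esin u * ecos x = esin (x + u) - esin (x - u).
Proof. by rewrite !esinD ecosN esinN; ring. Qed.

Lemma two_esin_esin u x : 2 * esin u * esin x = ecos (x - u) - ecos (x + u).
Proof. by rewrite !ecosD ecosN esinN; ring. Qed.

Lemma sum_ecos_geom M u :
  2 * esin (u / 2) * \sum_(m < M) ecos (m%:R * u) = esin (M%:R * u - u / 2) + esin (u / 2).
Proof.
elim: M => [|M IH]; first by rewrite big_ord0 mul0r sub0r esinN mulr0 addNr.
rewrite big_ord_recr /= mulrDr IH two_esin_ecos.
have -> : M.+1%:R * u - u / 2 = M%:R * u + u / 2 by rewrite -natr1; field.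
by ring.
Qed.

Lemma sum_esin_geom M u :
  2 * esin (u / 2) * \sum_(m < M) esin (m%:R * u) = ecos (u / 2) - ecos (M%:R * u - u / 2).
Proof.
elim: M => [|M IH]; first by rewrite big_ord0 mul0r sub0r ecosN mulr0 subrr.
rewrite big_ord_recr /= mulrDr IH two_esin_esin.
have -> : M.+1%:R * u - u / 2 = M%:R * u + u / 2 by rewrite -natr1; field.
by ring.
Qed.

(** The squared modulus of the sum of e(m u) for m < M: M times the usual Fejer
    kernel. *)
Definition fejer M u : R :=
  (\sum_(m < M) ecos (m%:R * u)) ^+ 2 + (\sum_(m < M) esin (m%:R * u)) ^+ 2.

Lemma fejer_ge0 M u : 0 <= fejer M u.
Proof. by rewrite addr_ge0// sqr_ge0. Qed.

Lemma esin_half_sqr u : 2 * esin (u / 2) ^+ 2 = 1 - ecos u.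
Proof.
have := two_esin_esin (u / 2) (u / 2).
by rewrite subrr ecos0 -splitr -mulrA -expr2.
Qed.

(** The geometric sum is bounded by 2 / |e(u) - 1|. *)
Lemma fejer_le M u c : ecos u <= c -> c < 1 -> fejer M u <= 4 / (1 - c).
Proof.
move=> uc c1; rewrite ler_pdivlMr ?subr_gt0//.
apply: le_trans (_ : fejer M u * (1 - ecos u) <= _).
  by rewrite ler_wpM2l ?fejer_ge0// lerB.
have := sum_ecos_geom M u; have := sum_esin_geom M u.
rewrite -esin_half_sqr /fejer.
set s := esin (u / 2); set A := \sum_(m < M) ecos _; set B := \sum_(m < M) esin _.
move=> HB HA.
have -> : (A ^+ 2 + B ^+ 2) * (2 * s ^+ 2) = ((2 * s * A) ^+ 2 + (2 * s * B) ^+ 2) / 2.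
  by field.
rewrite HA HB.
have := ecos2Desin2 (u / 2); have := ecos2Desin2 (M%:R * u - u / 2).
rewrite -/s; set a := ecos (M%:R * u - u / 2); set b := esin (M%:R * u - u / 2).
set d := ecos (u / 2) => e1 e2.
have : 0 <= (b - s) ^+ 2 + (d + a) ^+ 2 by rewrite addr_ge0// sqr_ge0.
nra.
Qed.

(** The Q-th roots of unity, raised to a power not divisible by Q, sum to 0. *)
Lemma sum_grid_ecos Q l x : (0 < l < Q)%N ->
  \sum_(k < Q) ecos (x + l%:R * (k%:R / Q%:R)) = 0.
Proof.
move=> /andP[l0 lQ]; have hQ : (0 < Q)%N by exact: leq_ltn_trans lQ.
have Q0 : Q%:R != 0 :> R by rewrite pnatr_eq0 -lt0n.
have Qp : 0 < Q%:R :> R by rewrite lt0r Q0/=.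
set u : R := l%:R / Q%:R.
have uE (k : nat) : l%:R * (k%:R / Q%:R) = k%:R * u by rewrite /u; ring.
have s0 : esin (u / 2) != 0.
  rewrite gt_eqF// /esin sin_gt0_pi//.
  have -> : pi *+ 2 * (u / 2) = pi * u by rewrite -mulr_natl; field.
  rewrite mulr_gt0 ?pi_gt0 ?divr_gt0 ?ltr0n//=.
  by rewrite gtr_pMr ?pi_gt0// ltr_pdivrMr// mul1r ltr_nat.
have Qu : Q%:R * u - u / 2 = - (u / 2) + l%:R by rewrite /u mulrCA mulfV// mulr1 addrC.
have c0 : \sum_(k < Q) ecos (k%:R * u) = 0.
  apply/eqP; have := sum_ecos_geom Q u.
  rewrite Qu esinDn esinN addNr => /eqP; rewrite mulf_eq0 => /orP[|//].
  by rewrite mulf_eq0 pnatr_eq0/= (negPf s0).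
have s00 : \sum_(k < Q) esin (k%:R * u) = 0.
  apply/eqP; have := sum_esin_geom Q u.
  rewrite Qu ecosDn ecosN subrr => /eqP; rewrite mulf_eq0 => /orP[|//].
  by rewrite mulf_eq0 pnatr_eq0/= (negPf s0).
under eq_bigr do rewrite uE ecosD.
by rewrite sumrB -!mulr_sumr c0 s00 !mulr0 subrr.
Qed.

Lemma ecos_natB (n m : nat) x :
  ecos ((n%:R - m%:R) * x) = ecos (((n - m) + (m - n))%:R * x).
Proof.
have [mn|nm] := leqP m n.
  by rewrite -natrB// (_ : m - n = 0)%N ?addn0//; lia.
rewrite -ecosN -mulNr opprB -natrB ?(ltnW nm)//.
by rewrite (_ : n - m = 0)%N ?add0n//; lia.
Qed.

Lemma fejerE M u :
  fejer M u = \sum_(n < M) \sum_(m < M) ecos (((n - m) + (m - n))%:R * u).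
Proof.
rewrite /fejer (sq_sum_ecos_esin (fun n => n%:R)).
by apply: eq_bigr => n _; apply: eq_bigr => m _; exact: ecos_natB.
Qed.

Lemma sum_diag M (c : R) : \sum_(n < M) \sum_(m < M) (if n == m then c else 0) = M%:R * c.
Proof.
under eq_bigr => n _.
  rewrite -big_mkcond (big_pred1 n); last by move=> m; rewrite eq_sym.
  over.
by rewrite sumr_const card_ord mulr_natl.
Qed.

(** Frequencies below Q do not see the difference between the uniform measure on
    the grid and Lebesgue measure; this replaces the integral of the kernel. *)
Lemma sum_grid_fejer Q x :
  \sum_(k < Q) fejer Q (x - k%:R / Q%:R) = Q%:R ^+ 2.
Proof.
under eq_bigr do rewrite fejerE.
rewrite exchange_big /=; under eq_bigr do rewrite exchange_big /=.
rewrite expr2 -sum_diag; apply: eq_bigr => n _; apply: eq_bigr => m _.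
have [->|nm] := eqVneq n m.
  under eq_bigr do rewrite subnn mul0r ecos0.
  by rewrite sumr_const card_ord.
set l := (_ + _)%N.
have nm' : n != m :> nat by [].
under eq_bigr do rewrite mulrBr -ecosN opprB addrC.
by apply: sum_grid_ecos; rewrite /l; have := ltn_ord n; have := ltn_ord m; lia.
Qed.

Lemma cvg_mean_fejer (y : nat -> R) Q x :
  (forall h, (0 < h)%N -> mean (fun i => ecos (h%:R * y i)) N @[N --> \oo] --> 0) ->
  (forall h, (0 < h)%N -> mean (fun i => esin (h%:R * y i)) N @[N --> \oo] --> 0) ->
  mean (fun i => fejer Q (y i - x)) N @[N --> \oo] --> (Q%:R : R).
Proof.
move=> Hc Hs; rewrite -[X in _ --> X](mulr1 (Q%:R : R)) -sum_diag.
under eq_fun => N do under eq_fun do rewrite fejerE.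
apply: cvg_mean_sum => n _; apply: cvg_mean_sum => m _.
have [->|nm] := eqVneq n m.
  under eq_fun do under eq_fun do rewrite subnn mul0r ecos0.
  exact: cvg_mean_cst.
set l := (_ + _)%N.
have nm' : n != m :> nat by [].
have l0 : (0 < l)%N by rewrite /l; lia.
have E : (fun N => mean (fun i => ecos (l%:R * (y i - x))) N) =
   (fun N => ecos (l%:R * x) * mean (fun i => ecos (l%:R * y i)) N
           + esin (l%:R * x) * mean (fun i => esin (l%:R * y i)) N).
  apply/funext => N; rewrite -!meanZ -meanD; congr (mean _ N).
  by apply/funext => i; rewrite mulrBr ecosB mulrC [_ * esin _]mulrC.
rewrite E -[X in _ --> X](addr0 0).
apply: cvgD.
  by rewrite -[X in _ --> X](mulr0 (ecos (l%:R * x))); apply: cvgM; [exact: cvg_cst|exact: Hc].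
by rewrite -[X in _ --> X](mulr0 (esin (l%:R * x))); apply: cvgM; [exact: cvg_cst|exact: Hs].
Qed.

End fejer_kernel.

(** * Localisation of the Fejer kernel near a cell *)

Section weyl_criterion.
Context {R : realType}.

Lemma count_interval Q A D :
  (\sum_(k < Q) (A <= k < D) <= D - A)%N.
Proof.
apply: (@leq_trans (minn Q D - A)); last by rewrite leq_sub2r// geq_minr.
elim: Q => [|Q IH]; first by rewrite big_ord0.
rewrite big_ord_recr /=; move: (\sum_(k < Q) _)%N IH => s IH.
by case: (leqP A Q) => AQ; case: (ltnP Q D) => QD /=; lia.
Qed.

(** The grid points k / (P q) within 1 / P of the interval [w / B, (w + 1) / B[
    modulo 1, where P = B p.  Both ends of [0, 1[ are always included, which
    takes care of wrapping around and costs only O(q) points. *)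
Definition near_cell P q (w p k : nat) : bool :=
  [|| (w * p * q <= k + q)%N && (k < (w.+1 * p).+1 * q)%N, (k < q)%N
    | (P * q <= k + q)%N].

Lemma card_near_cell P q w p :
  (\sum_(k < P * q) near_cell P q w p k <= (p + 4) * q)%N.
Proof.
have E : ((w.+1 * p).+1 * q = w * p * q + p * q + q)%N by ring.
apply: (@leq_trans (\sum_(k < P * q)
   ((w * p * q - q <= k < (w.+1 * p).+1 * q) + (0 <= k < q) + (P * q - q <= k < P * q)))%N).
  apply: leq_sum => k _; rewrite /near_cell; have := ltn_ord k; lia.
rewrite !big_split.
apply: leq_trans (leq_add (leq_add (count_interval _ _ _) (count_interval _ _ _))
  (count_interval _ _ _)) _.
by rewrite E; lia.
Qed.

Lemma half_turn (z : R) : 0 <= z -> z <= 2^-1 -> pi *+ 2 * z \in `[0, pi].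
Proof.
have p0 := pi_gt0 R.
by move=> z0 z2; rewrite in_itv/= -mulr_natl; apply/andP; split; nra.
Qed.

(** On [1 / P, 1 - 1 / P] the cosine of period 1 is largest at the ends. *)
Lemma ecos_away (P : nat) (v : R) : (2 <= P)%N ->
  P%:R^-1 <= `|v| <= 1 - P%:R^-1 -> ecos v <= ecos P%:R^-1.
Proof.
move=> P2 /andP[v0 v1].
have P0 : 0 < P%:R^-1 :> R by rewrite invr_gt0 ltr0n ltnW.
wlog v12 : v v0 v1 / 0 <= v <= 2^-1 => [H|].
  have -> : ecos v = ecos `|v|.
    by have [] := leP 0 v => [/ger0_norm->|/ltr0_norm->]//; rewrite ecosN.
  have [h|h] := leP `|v| 2^-1; first by apply: H; rewrite ?normr_id// normr_ge0.
  have -> : ecos `|v| = ecos (1 - `|v|).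
    by rewrite -ecosN -(ecosDn _ 1) addrC.
  have w0 : 0 <= 1 - `|v| by lra.
  by apply: H; rewrite ?(ger0_norm w0) ?w0/=; lra.
have /andP[v00 v2] := v12.
rewrite ger0_norm// in v0 v1.
have [->//|vP] := eqVneq v P%:R^-1.
have lt : P%:R^-1 < v by rewrite lt_neqAle eq_sym vP.
have p0 := pi_gt0 R.
rewrite /ecos ltW// ltr_cos; [|apply: half_turn; lra|apply: half_turn; lra].
by rewrite ltr_pM2l// mulrn_wgt0.
Qed.


Lemma ecos_inv_lt1 (P : nat) : (2 <= P)%N -> ecos P%:R^-1 < 1 :> R.
Proof.
move=> P2; have p0 := pi_gt0 R.
have PR : 0 < P%:R :> R by rewrite ltr0n ltnW.
rewrite -[ltRHS]ecos0 /ecos ltr_cos; last 2 first.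
- exact: half_turn.
- by apply: half_turn; rewrite ?invr_ge0 ?lef_pV2 ?posrE ?ler_nat.
by rewrite mulr0 divr_gt0// mulrn_wgt0.
Qed.

(** If y lies modulo 1 in [w / B, (w + 1) / B[ and k / Q is not near this cell,
    then y and k / Q differ modulo 1 by at least 1 / P. *)
Lemma fejer_far (P q w p Q M k : nat) (B : nat) (y : R) :
  P = (B * p)%N -> Q = (P * q)%N -> (0 < p)%N -> (0 < B)%N -> (0 < q)%N -> (2 <= P)%N ->
  0 <= y -> (Num.truncn (B%:R * y) %% B)%N = w -> (k < Q)%N ->
  ~~ near_cell P q w p k ->
  fejer M (y - k%:R / Q%:R) <= 4 / (1 - ecos (P%:R^-1 : R)).
Proof.
move=> PE QE p0 B0 q0 P2 y0 yw kQ far.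
have Qp : (0 < Q)%N by rewrite QE PE !muln_gt0 p0 q0 B0.
have Bp : 0 < B%:R :> R by rewrite ltr0n.
have QR : 0 < Q%:R :> R by rewrite ltr0n.
have PR : 0 < P%:R :> R by rewrite ltr0n ltnW.
set i := (Num.truncn (B%:R * y) %/ B)%N.
pose v := y - i%:R - k%:R / Q%:R.
apply: fejer_le; last exact: ecos_inv_lt1.
have -> : y - k%:R / Q%:R = v + i%:R by rewrite /v; ring.
rewrite ecosDn; apply: ecos_away => //.
have /andP[t1 t2] := truncn_itv (mulr_ge0 (ltW Bp) y0).
have wB : (w < B)%N by rewrite -yw ltn_mod.
move: t1 t2; rewrite -natr1 (divn_eq (Num.truncn (B%:R * y)) B) -/i yw natrD natrM => t1 t2.
pose f := y - i%:R; pose z := (p * q)%:R * (B%:R * f) - k%:R.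
have pq0 : 0 < (p * q)%:R :> R by rewrite ltr0n muln_gt0 p0.
have f1 : (p * q)%:R * w%:R <= (p * q)%:R * (B%:R * f) by rewrite ler_pM2l// /f; lra.
have f2 : (p * q)%:R * (B%:R * f) < (p * q)%:R * (w%:R + 1) by rewrite ltr_pM2l// /f; lra.
have vz : v = z / Q%:R.
  rewrite /z /v -/f mulrBl; congr (_ - _).
  by rewrite QE PE !natrM; field; rewrite !pnatr_eq0 -!lt0n p0 q0 B0.
have Pq : P%:R^-1 = q%:R / Q%:R :> R.
  by rewrite QE natrM; field; rewrite !pnatr_eq0 -!lt0n q0 (ltnW P2).
have wpq : ((w * p * q)%:R = (p * q)%:R * w%:R :> R) by rewrite -natrM -mulnA mulnC.
rewrite vz normrM normfV (ger0_norm (ltW QR)) Pq ler_pdivlMr// divfK ?gt_eqF//.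
rewrite ler_pdivrMr// mulrBl mul1r divfK ?gt_eqF//.
move: far; rewrite /near_cell !negb_or negb_and -!ltnNge => /and3P[far qk' kq].
have qk : q%:R <= k%:R :> R by rewrite ler_nat.
have kQq : k%:R + q%:R <= Q%:R :> R by rewrite -natrD ler_nat QE ltnW.
have wQ : (p * q)%:R * (w%:R + 1) <= Q%:R :> R.
  by rewrite natr1 -natrM ler_nat QE PE -(mulnA B) mulnC leq_mul2r wB orbT.
have w0 : 0 <= (p * q)%:R * w%:R :> R by rewrite mulr_ge0// ltW.
case/orP: far => [h|h].
  have h' : k%:R + q%:R <= (p * q)%:R * w%:R :> R.
    by rewrite -natrD -wpq ler_nat ltnW.
  have z0 : 0 <= z by rewrite /z; have := ler0n R q; lra.
  by rewrite ger0_norm// /z; lra.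
have h' : (p * q)%:R * (w%:R + 1) + q%:R <= k%:R :> R.
  rewrite natr1 -natrM -natrD ler_nat.
  by rewrite (_ : p * q * w.+1 + q = (w.+1 * p).+1 * q)%N//; ring.
have z0 : z <= 0 by rewrite /z; have := ler0n R q; lra.
by rewrite ler0_norm// /z; lra.
Qed.

End weyl_criterion.

(** * From vanishing exponential means to normality *)

Section normal_numbers.
Context {R : realType}.

(** The sum G of the kernel over the grid points near the cell is
    nonnegative, and close to Q^2 when y i lies in the cell, by
    [fejer_far] and [sum_grid_fejer]; so G / Q^2 dominates the indicator of the
    cell up to a small error.  The Cesaro mean of G / Q^2 tends to the
    proportion of grid points near the cell, which is close to 1 / B. *)
Lemma weyl_upper (y : nat -> R) (B w : nat) (eps : R) :
  (forall i, 0 <= y i) ->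
  (forall h, (0 < h)%N -> mean (fun i => ecos (h%:R * y i)) N @[N --> \oo] --> 0) ->
  (forall h, (0 < h)%N -> mean (fun i => esin (h%:R * y i)) N @[N --> \oo] --> 0) ->
  (0 < B)%N -> 0 < eps ->
  \forall N \near \oo,
    mean (fun i => (Num.truncn (B%:R * y i) %% B == w)%N%:R) N <= B%:R^-1 + eps.
Proof.
move=> y0 Hc Hs B0 eps0.
(* P = B p fixes the resolution 1 / P; the grid is then refined by q until
   the mass of the kernel away from the cell is negligible. *)
set p := (Num.truncn (12 / eps)).+2.
set P := (B * p)%N.
have P2 : (2 <= P)%N by rewrite (@leq_trans (1 * p))// leq_mul2r B0 orbT.
set D : R := 4 / (1 - ecos P%:R^-1).
have D0 : 0 < D by rewrite divr_gt0// subr_gt0 ecos_inv_lt1.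
set q := (Num.truncn (3 * D / eps)).+1.
set Q := (P * q)%N.
have q0 : (0 < q)%N by [].
have BR : 0 < B%:R :> R by rewrite ltr0n.
have PR : 0 < P%:R :> R by rewrite ltr0n ltnW.
have qR : 0 < q%:R :> R by rewrite ltr0n.
have QR : 0 < Q%:R :> R by rewrite ltr0n muln_gt0 (ltnW P2).
have pR : 0 < p%:R :> R by rewrite ltr0n.
have pbig : 4 / p%:R <= eps / 3.
  have : 12 / eps < p%:R.
    by apply: lt_trans (truncnS_gt _) _; rewrite ltr_nat.
  rewrite ltr_pdivrMr// ler_pdivrMr//; lra.
have qbig : D <= Q%:R * (eps / 3).
  have : 3 * D / eps < q%:R by exact: truncnS_gt.
  rewrite ltr_pdivrMr// => h.
  have : q%:R <= Q%:R :> R by rewrite ler_nat leq_pmull// ltnW.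
  nra.
pose J k := near_cell P q w p k.
pose G i := \sum_(k < Q | J k) fejer Q (y i - k%:R / Q%:R).
have G0 i : 0 <= G i by apply: sumr_ge0 => k _; exact: fejer_ge0.
have GE i : Q%:R ^+ 2 * (Num.truncn (B%:R * y i) %% B == w)%N%:R <= G i + Q%:R * D.
  case: eqP => [yw|_]; last by rewrite mulr0 addr_ge0// mulr_ge0 ?ltW.
  rewrite mulr1 -(sum_grid_fejer Q (y i)) (bigID (fun k : 'I_Q => J k)) /= lerD2l.
  apply: le_trans (_ : \sum_(k < Q | ~~ J k) D <= _).
    by apply: ler_sum => k Jk; apply: (@fejer_far _ P q w p Q Q k B (y i)) => //.
  rewrite sumr_const -[leLHS]mulr_natl ler_wpM2r ?(ltW D0)// ler_nat.
  by apply: leq_trans (max_card _) _; rewrite card_ord.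
have cardJ : (\sum_(k < Q | J k) 1)%:R <= (p%:R + 4) * q%:R :> R.
  rewrite -natrD -natrM ler_nat big_mkcond/=; exact: card_near_cell.
have cG : mean G N @[N --> \oo] --> \sum_(k < Q | J k) (Q%:R : R).
  by apply: cvg_mean_sum => k _; exact: cvg_mean_fejer.
have JQ : \sum_(k < Q | J k) (Q%:R : R) = Q%:R * (\sum_(k < Q | J k) 1)%:R.
  by rewrite sumr_const sum1_card mulr_natr.
have e3 : 0 < Q%:R ^+ 2 * (eps / 3) by rewrite mulr_gt0 ?exprn_gt0// divr_gt0.
move/cvgr_lt : cG => /(_ (\sum_(k < Q | J k) (Q%:R : R) + Q%:R ^+ 2 * (eps / 3))).
rewrite ltrDl e3 => /(_ isT) [N0 _ HN].
exists N0.+1 => // N /= NN; have {}HN := HN N (ltnW NN).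
have N1 : (0 < N)%N by exact: leq_ltn_trans NN.
have Q2 : 0 < Q%:R ^+ 2 :> R by exact: exprn_gt0.
rewrite -(ler_pM2l Q2) -meanZ.
apply: le_trans (le_mean _ GE) _.
rewrite meanD mean_cst//.
have H1 : Q%:R * D <= Q%:R ^+ 2 * (eps / 3) by rewrite expr2 -mulrA ler_pM2l.
have H2 : Q%:R * (\sum_(k < Q | J k) 1)%:R <= Q%:R ^+ 2 * (B%:R^-1 + eps / 3).
  rewrite expr2 -mulrA ler_pM2l//; apply: le_trans cardJ _.
  rewrite /Q natrM mulrAC ler_pM2r// /P natrM mulrDr mulrAC mulfV ?gt_eqF// mul1r lerD2l.
  rewrite -ler_pdivrMl ?mulr_gt0// mulrC; apply: (le_trans _ pbig).
  rewrite ler_pM2l// lef_pV2 ?posrE ?mulr_gt0//.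
  by rewrite ler_peMl ?ler1n// ltW.
rewrite JQ in HN; move: HN => /= HN.
apply: le_trans (_ : Q%:R * (\sum_(k < Q | J k) 1)%:R + Q%:R ^+ 2 * (eps / 3)
   + Q%:R * D <= _).
  by rewrite lerD2r; exact: ltW.
have -> : Q%:R ^+ 2 * (B%:R^-1 + eps) =
  Q%:R ^+ 2 * (B%:R^-1 + eps / 3) + Q%:R ^+ 2 * (eps / 3) + Q%:R ^+ 2 * (eps / 3).
  by field; rewrite gt_eqF.
lra.
Qed.

Lemma truncn_divX (b m r : nat) (x : R) : (0 < b)%N -> 0 <= x ->
  (Num.truncn (b%:R ^+ (m + r) * x) %/ b ^ r)%N = Num.truncn (b%:R ^+ m * x).
Proof.
move=> b0 x0; apply/esym/truncn_def.
have br : 0 < (b ^ r)%:R :> R by rewrite ltr0n expn_gt0 b0.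
have z0 : 0 <= b%:R ^+ (m + r) * x by rewrite mulr_ge0// exprn_ge0.
have /andP[t1 t2] := truncn_itv z0.
have E : b%:R ^+ (m + r) * x = (b%:R ^+ m * x) * (b ^ r)%:R.
  by rewrite exprD natrX mulrAC.
apply/andP; split.
  rewrite -(ler_pM2r br) -E -natrM; apply: (le_trans _ t1).
  by rewrite ler_nat leq_trunc_div.
rewrite -(ltr_pM2r br) -E -natrM; apply: lt_le_trans t2 _.
by rewrite ler_nat ltn_ceil// expn_gt0 b0.
Qed.

Lemma modn_expn_digits (b Z L : nat) : (0 < b)%N ->
  (Z %% b ^ L = \sum_(i < L) (Z %/ b ^ i %% b) * b ^ i)%N.
Proof.
move=> b0; elim: L => [|L IH]; first by rewrite big_ord0 modn1.
rewrite big_ord_recr /= -IH expnS.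
rewrite {1}(divn_eq Z (b ^ L)) {1}(divn_eq (Z %/ b ^ L) b).
have -> : (((Z %/ b ^ L %/ b * b + Z %/ b ^ L %% b) * b ^ L + Z %% b ^ L) =
   Z %/ b ^ L %/ b * (b * b ^ L) + (Z %% b ^ L + Z %/ b ^ L %% b * b ^ L))%N by ring.
rewrite modnMDl modn_small//.
have r1 : (Z %/ b ^ L %% b < b)%N by rewrite ltn_mod.
have r2 : (Z %% b ^ L < b ^ L)%N by rewrite ltn_mod expn_gt0 b0.
apply: leq_trans (_ : b ^ L + Z %/ b ^ L %% b * b ^ L <= _)%N.
  by rewrite -addSn leq_add2r.
by rewrite -mulSn leq_mul2r r1 orbT.
Qed.

(** The number with base b digits w, most significant digit first. *)
Definition block_value (b L : nat) (w : L.-tuple 'I_b) : nat :=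
  (\sum_(i < L) tnth w (rev_ord i) * b ^ i)%N.

(** Reading the block w at position k confines b^k x, modulo 1, to one b-adic
    interval of length b^-L. *)
Lemma block_cell (b L k : nat) (w : L.-tuple 'I_b) (x : R) : (0 < b)%N -> 0 <= x ->
  [forall j : 'I_L, digit b x (k + j).+1 == tnth w j] ->
  (Num.truncn ((b ^ L)%:R * (b%:R ^+ k * x)) %% b ^ L)%N = block_value w.
Proof.
move=> b0 x0 /forallP dw; rewrite modn_expn_digits// natrX mulrA -exprD.
apply: eq_bigr => i _; congr (_ * _)%N; rewrite -(eqP (dw (rev_ord i))) /digit.
rewrite -(@truncn_divX b (k + rev_ord i).+1 i)//.
congr (Num.truncn (_ ^+ _ * _) %/ _ %% _)%N.
by rewrite /=; have := ltn_ord i; lia.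
Qed.

(** Each block has upper frequency at most b^-L by [weyl_upper].  As exactly one
    block of length L is read at each position, no frequency can be smaller
    without another one being larger. *)
Lemma normal_of_vanishing_means (b : nat) (x : R) :
  (2 <= b)%N -> 0 <= x < 1 ->
  (forall h, (0 < h)%N ->
     mean (fun i => ecos ((h * b ^ i)%:R * x)) N @[N --> \oo] --> 0) ->
  (forall h, (0 < h)%N ->
     mean (fun i => esin ((h * b ^ i)%:R * x)) N @[N --> \oo] --> 0) ->
  normal_to_base b x.
Proof.
move=> b2 x01 Hc Hs; split => // L w.
have b0 : (0 < b)%N by exact: ltnW.
have x0 : 0 <= x by case/andP: x01.
pose ev (v : L.-tuple 'I_b) k := [forall j : 'I_L, digit b x (k + j).+1 == tnth v j].
have freqE v n : (block_count x v n)%:R / n%:R = mean (fun k => (ev v k)%:R) n :> R.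
  by rewrite /mean /block_count -sum1_card natr_sum big_mkcond /=; congr (_ / _);
    apply: eq_bigr => k _; rewrite /ev unfold_in /=; case: ifP.
under eq_fun do rewrite freqE.
set B := (b ^ L)%N.
have B0 : (0 < B)%N by rewrite expn_gt0 b0.
have BR : 0 < B%:R :> R by rewrite ltr0n.
have upper v (eps : R) : 0 < eps ->
    \forall N \near \oo, mean (fun k => (ev v k)%:R) N <= B%:R^-1 + eps.
  move=> eps0.
  have := @weyl_upper (fun k => b%:R ^+ k * x) B (block_value v) eps _ _ _ B0 eps0.
  move=> /(_ (fun i => mulr_ge0 (exprn_ge0 _ (ler0n _ _)) x0)).
  have E h i : h%:R * (b%:R ^+ i * x) = (h * b ^ i)%:R * x by rewrite mulrA natrM natrX.
  case=> [h h0|h h0|N0 _ HN].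
  - by under eq_fun do under eq_fun do rewrite E; exact: Hc.
  - by under eq_fun do under eq_fun do rewrite E; exact: Hs.
  exists N0 => // N /HN; apply: le_trans; apply: le_mean => k.
  by rewrite ler_nat; case: (boolP (ev v k)) => // /block_cell ->; rewrite ?eqxx.
have total k : \sum_v (ev v k)%:R = 1 :> R.
  have dig j : (digit b x (k + j).+1 < b)%N by rewrite ltn_mod.
  (* The block actually read at position k. *)
  pose v0 := [tuple Ordinal (dig j) | j < L].
  rewrite (bigD1 v0)//= big1 ?addr0.
    by rewrite (_ : ev v0 k)//; apply/forallP => j; rewrite tnth_mktuple.
  move=> v vv0; case: (boolP (ev v k)) => // /forallP dv; case/eqP: vv0.
  apply/eq_from_tnth => j; rewrite tnth_mktuple; apply/val_inj => /=.
  by rewrite (eqP (dv j)).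
have -> : b%:R ^- L = B%:R^-1 :> R by rewrite natrX.
apply/cvgrPdist_le => eps eps0.
(* Small enough for the errors of all B blocks to add up to eps. *)
pose d := eps / B%:R.
have d0 : 0 < d by rewrite divr_gt0.
have : \forall N \near \oo, forall v, mean (fun k => (ev v k)%:R) N <= B%:R^-1 + d.
  by apply: filter_forall => v; exact: upper.
move=> [N0 _ HN]; exists N0.+1 => // N /= NN.
have {}HN := HN N (ltnW NN).
have N1 : (0 < N)%N by exact: leq_ltn_trans NN.
have S : \sum_v mean (fun k => (ev v k)%:R) N = 1 :> R.
  rewrite -mean_sum -[RHS](mean_cst 1 N1); congr (mean _ N).
  by apply/funext => k; exact: total.
have lower : 1 - mean (fun k => (ev w k)%:R) N <= (B%:R - 1) * (B%:R^-1 + d).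
  rewrite -[X in X - _]S (bigD1 w)//= addrAC subrr add0r.
  apply: le_trans (ler_sum _ (fun v _ => HN v)) _.
  rewrite sumr_const -[leLHS]mulr_natl ler_wpM2r//.
    by rewrite addr_ge0 ?invr_ge0// ltW.
  rewrite cardC1.
  rewrite card_tuple card_ord -/B -subn1 natrB//.
have Bd : B%:R * d = eps by rewrite /d mulrC divfK// gt_eqF.
have BB : B%:R * B%:R^-1 = 1 :> R by rewrite mulfV// gt_eqF.
have deps : d <= eps by rewrite -Bd ler_peMl ?ler1n// ltW.
have up := HN w.
rewrite ler_distlC; apply/andP; split; nra.
Qed.

End normal_numbers.

(** * Almost sure behaviour of the exponential means *)

Section almost_everywhere_means.
Context {R : realType}.
Context (phi : nat -> R).
Context (phi01 : forall n, (1 <= n)%N -> 0 < phi n < 1).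
Context (phi_mono : forall m n, (1 <= m)%N -> (m <= n)%N -> phi n <= phi m).
Context (phi_to0 : phi n @[n --> \oo] --> 0).
Context (nu : nat -> probability R R).
Context (nuE : forall n, (1 <= n)%N -> forall A : set R,
       measurable A ->
       nu n A = ((2^-1 * (1 + phi n))%:E * \d_(0%R : R) A +
                 (2^-1 * (1 - phi n))%:E * \d_(2%R ^- n : R)%R A)%E).
Context (mu : probability R R).
Context (mu_conv : is_infinite_convolution nu mu).

Lemma continuous_scale (f : R -> R) (c : R) :
  continuous f -> continuous (fun x : R => f (c * x)).
Proof.
move=> cf x; apply: (@continuous_comp _ _ _ (fun x : R => c * x) f); last exact: cf.
by apply: cvgM; [exact: cvg_cst|exact: cvg_id].
Qed.

Lemma continuous_sum_sqr (F : nat -> R -> R) K :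
  (forall n, continuous (F n)) -> continuous (fun x : R => (\sum_(n < K) F n x) ^+ 2).
Proof.
move=> cF x; apply: (@continuous_comp _ _ _ (fun x : R => \sum_(n < K) F n x)
  (fun z : R => z ^+ 2)).
  by apply: cvg_big; [exact: add_continuous|move=> i _; exact: cF].
exact: exprn_continuous.
Qed.

Lemma sum_sqr_bounded (F : nat -> R -> R) (B : R) K x :
  (forall n x, `|F n x| <= B) -> `|(\sum_(n < K) F n x) ^+ 2| <= (K%:R * B) ^+ 2.
Proof.
move=> FB; rewrite normrX; have B0 : 0 <= B by exact: le_trans (FB 0%N 0).
apply: lerXn2r; rewrite ?nnegrE ?mulr_ge0//.
apply: le_trans (ler_norm_sum _ _ _) _.
apply: (@le_trans _ _ (\sum_(n < K) B)); first by apply: ler_sum => n _; exact: FB.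
by rewrite sumr_const card_ord mulr_natl.
Qed.

Lemma ereal_integral_le (f : R -> R) C D :
  continuous f -> (forall x, `|f x| <= C) -> \int[mu]_x f x <= D ->
  (\int[mu]_x (f x)%:E <= D%:E)%E.
Proof.
move=> cf fC fD; rewrite -[leLHS]fineK ?lee_fin//.
exact: integrable_fin_num (continuous_bounded_integrable mu cf fC).
Qed.

(** The squares of the real and imaginary parts are bounded by the squared
    modulus, which [second_moment_orbit] controls. *)
Lemma ae_means_odd_part a b' h : odd b' -> (3 <= b')%N -> (0 < h)%N ->
  {ae mu, forall x,
    mean (fun n => ecos ((h * (2 ^ a * b') ^ n)%:R * x)) N @[N --> \oo] --> 0 /\
    mean (fun n => esin ((h * (2 ^ a * b') ^ n)%:R * x)) N @[N --> \oo] --> 0}.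
Proof.
move=> ob b3 h0; have [rho rho01 H] := second_moment_orbit phi01 phi_mono a ob b3 h0.
set t := fun n => (h * (2 ^ a * b') ^ n)%:R : R.
have main (f : R -> R) : continuous f -> (forall x, `|f x| <= 1) ->
    (forall K x, (\sum_(n < K) f (t n * x)) ^+ 2 <=
      (\sum_(n < K) ecos (t n * x)) ^+ 2 + (\sum_(n < K) esin (t n * x)) ^+ 2) ->
    {ae mu, forall x, mean (fun n => f (t n * x)) N @[N --> \oo] --> 0}.
  move=> cf f1 fle.
  apply: (@ae_mean_cvg0 R _ _ mu (fun n x => f (t n * x)) 1 5 rho) => //.
    by move=> n; apply: continuous_measurable_fun; exact: continuous_scale.
  move=> K K0; have cS : continuous (fun x : R => (\sum_(n < K) f (t n * x)) ^+ 2).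
    exact: (@continuous_sum_sqr (fun n x => f (t n * x)) K
      (fun n => @continuous_scale f (t n) cf)).
  have bS x : `|(\sum_(n < K) f (t n * x)) ^+ 2| <= (K%:R * 1) ^+ 2.
    by apply: (@sum_sqr_bounded (fun n x => f (t n * x)) 1).
  apply: (ereal_integral_le cS bS).
  apply: (integral_le_of_bitE phi01 nuE mu_conv cS bS).
  have [N0 HN] := H K K0; exists N0 => N /HN; apply: le_trans.
  by apply: bitE_le => // i _; exact: fle.
have mc := main _ continuous_ecos ecos_le1 (fun K x => ler_wpDr (sqr_ge0 _) (lexx _)).
have ms := main _ continuous_esin esin_le1 (fun K x => ler_wpDl (sqr_ge0 _) (lexx _)).
by apply: filterS2 mc ms => x.
Qed.

Lemma cvg_mean (u : nat -> R) : u n @[n --> \oo] --> 0 -> mean u N @[N --> \oo] --> 0.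
Proof.
move=> /cesaro; rewrite /arithmetic_mean => H; rewrite -cvg_shiftS.
by under eq_fun do rewrite /mean mulrC -(big_mkord xpredT).
Qed.

(** The second moment of the centred sums is a variance in the limit: over N
    digits it differs from the variance by the square of the error made in
    replacing the expectation by its limit, which tends to 0. *)
Lemma ae_means_power_of_two (f : R -> R) (L : R) a : (0 < a)%N ->
  continuous f -> (forall x, `|f x| <= 1) -> (forall x n, f (x + n%:R) = f x) ->
  (forall x y, `|f x - f y| <= L * `|x - y|) ->
  \int[mu]_x f (((2 ^ a) ^ n)%:R * x) @[n --> \oo] --> 0 ->
  {ae mu, forall x, mean (fun n => f (((2 ^ a) ^ n)%:R * x)) N @[N --> \oo] --> 0}.
Proof.
move=> a0 cf f1 fper flip means0.
pose F n x := f (((2 ^ a) ^ n)%:R * x).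
have cF n : continuous (F n) by exact: continuous_scale.
have F1 n x : `|F n x| <= 1 by exact: f1.
set A := fun n => \int[mu]_x F n x in means0.
have FA n : bitE phi 0 N (F n) @[N --> \oo] --> A n.
  exact: (bitE_cvg_integral phi01 nuE mu_conv (cF n) (F1 n)).
have A1 n : `|A n| <= 1.
  have nA : `|bitE phi 0 N (F n)| @[N --> \oo] --> `|A n| by apply: cvg_norm; exact: FA.
  rewrite -(cvg_lim _ nA)//; apply: limr_le.
    by apply/cvg_ex; eexists; exact: nA.
  apply: nearW => N; rewrite -[X in `|X|]subr0 -[X in _ - X](@bitE_cst R phi 0 N).
  by apply: bitE_dist => // i _; rewrite subr0.
have L0 : 0 <= L by exact: lip_ge0 flip.
pose Y n x := F n x - A n.
have cY n : continuous (Y n) by move=> x; apply: cvgB; [exact: cF|exact: cvg_cst].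
have Y2 n x : `|Y n x| <= 2.
  by apply: le_trans (ler_normB _ _) _; rewrite (_ : 2 = 1 + 1)// lerD.
have : {ae mu, forall x, mean (fun n => Y n x) N @[N --> \oo] --> 0}.
  apply: (@ae_mean_cvg0 R _ _ mu Y 2 (4 * (1 + 2 * L)) 2^-1) => //.
  - by move=> n; exact: continuous_measurable_fun.
  - by apply/andP; split; lra.
  move=> K K0; have cS := @continuous_sum_sqr Y K cY.
  have bS x := @sum_sqr_bounded Y 2 K x Y2.
  apply: (ereal_integral_le cS bS).
  have S1 := bitE_cvg_integral phi01 nuE mu_conv cS bS.
  set SA := \sum_(n < K) A n.
  have S2 : bitE phi 0 N (fun x => \sum_(n < K) F n x) @[N --> \oo] --> SA.
    have -> : (fun N => bitE phi 0 N (fun x => \sum_(n < K) F n x)) =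
        (fun N => \sum_(n < K) bitE phi 0 N (F n)).
      by apply/funext => N; exact: bitE_sum.
    by apply: cvg_big => //; exact: add_continuous.
  have S3 : bitE phi 0 N (fun x => (\sum_(n < K) Y n x) ^+ 2)
      - (bitE phi 0 N (fun x => \sum_(n < K) F n x) - SA) ^+ 2 @[N --> \oo]
      --> \int[mu]_x (\sum_(n < K) Y n x) ^+ 2.
    rewrite -[X in _ --> X]subr0; apply: cvgB; first exact: S1.
    have e : (SA - SA) ^+ 2 = 0 by rewrite subrr expr0n.
    rewrite -[X in _ --> X]e.
    apply: (continuous_cvg _ (@exprn_continuous R 2 (SA - SA))).
    by apply: cvgB; [exact: S2|exact: cvg_cst].
  rewrite -(cvg_lim _ S3)//; apply: limr_le; first by apply/cvg_ex; eexists; exact: S3.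
  exists (a * K)%N => // N NK.
  have YE : bitE phi 0 N (fun x => (\sum_(n < K) Y n x) ^+ 2) =
      bitE phi 0 N (fun x => (\sum_(n < K) F n x) ^+ 2)
      - 2 * SA * bitE phi 0 N (fun x => \sum_(n < K) F n x) + SA ^+ 2.
    rewrite -mulNr -[SA ^+ 2](@bitE_cst R phi 0 N) -bitEZ -!bitED.
    by apply: bitE_ext => x; rewrite /Y sumrB -/SA; ring.
  have V := @variance_le R phi phi01 f L a a0 f1 fper flip K N NK.
  rewrite /= YE.
  apply: le_trans (_ : 4 * (1 + 2 * L) * K%:R <= _); first by rewrite -/(F _) in V; lra.
  rewrite -[leRHS]mulrA ler_wpM2l//; first by lra.
  rewrite expr2 -mulrA ler_peMr// exprVn.
  by rewrite ler_pdivlMr ?exprn_gt0// mul1r -natrX ler_nat trunc_logP.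
apply: filterS => x Y0.
have -> : (fun N => mean (fun n => f (((2 ^ a) ^ n)%:R * x)) N) =
    (fun N => mean (fun n => Y n x) N + mean A N).
  apply/funext => N; rewrite -meanD; congr (mean _ N).
  by apply/funext => n; rewrite /Y /F subrK.
by rewrite -[X in _ --> X](addr0 0); apply: cvgD => //; exact: cvg_mean.
Qed.

Lemma means_power_of_two_cvg0 (f : R -> R) a h : (0 < a)%N -> (0 < h)%N ->
  continuous f -> (forall x, `|f x| <= 1) ->
  (forall n N, bitE phi 0 N (fun x => f ((h * (2 ^ a) ^ n)%:R * x)) ^+ 2 <=
    bitE phi 0 N (fun x => ecos ((h * (2 ^ a) ^ n)%:R * x)) ^+ 2 +
    bitE phi 0 N (fun x => esin ((h * (2 ^ a) ^ n)%:R * x)) ^+ 2) ->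
  \int[mu]_x f ((h * (2 ^ a) ^ n)%:R * x) @[n --> \oo] --> 0.
Proof.
move=> a0 h0 cf f1 fle; apply/cvgr0Pnorm_lt => eps eps0.
move/cvgr0Pnorm_lt : phi_to0 => /(_ _ eps0) [n0 _ Hn]; exists n0 => // n /= nn.
set v := (a * n + logn 2 h).+1.
have nv : (n0 <= v)%N by rewrite /v; nia.
apply: le_lt_trans (Hn v nv).
have cF := @continuous_scale f (h * (2 ^ a) ^ n)%:R cf.
have H := bitE_cvg_integral phi01 nuE mu_conv cF (fun x => f1 _).
have H2 : bitE phi 0 N (fun x => f ((h * (2 ^ a) ^ n)%:R * x)) ^+ 2 @[N --> \oo]
    --> (\int[mu]_x f ((h * (2 ^ a) ^ n)%:R * x)) ^+ 2.
  exact: (continuous_cvg _ (@exprn_continuous R 2 _) H).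
rewrite -ler_sqr ?nnegrE// -!normrX !ger0_norm ?sqr_ge0//.
rewrite -(cvg_lim _ H2)//; apply: limr_le; first by apply/cvg_ex; eexists; exact: H2.
exists v => // N /= vN; apply: le_trans (fle n N) _.
exact: mean_power_of_two.
Qed.

Lemma ae_means b h : (2 <= b)%N -> (0 < h)%N ->
  {ae mu, forall x,
    mean (fun n => ecos ((h * b ^ n)%:R * x)) N @[N --> \oo] --> 0 /\
    mean (fun n => esin ((h * b ^ n)%:R * x)) N @[N --> \oo] --> 0}.
Proof.
move=> b2 h0.
have [b' /[!coprime2n] ob'] := pfactor_coprime (isT : prime 2) (ltnW b2).
rewrite mulnC; move: (logn 2 b) => a bE; rewrite bE in b2 *.
have [b'3|b'2] := leqP 3 b'; first exact: ae_means_odd_part.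
have b'1 : b' = 1%N by move: b'2 ob' {bE b2}; case: b' => [|[|[|]]].
rewrite b'1 muln1 in b2 *.
have a0 : (0 < a)%N by case: (a) b2.
have main (f : R -> R) : continuous f -> (forall x, `|f x| <= 1) ->
    (forall x n, f (x + n%:R) = f x) ->
    (forall x y, `|f x - f y| <= pi *+ 2 * `|x - y|) ->
    (forall n N, bitE phi 0 N (fun x => f ((h * (2 ^ a) ^ n)%:R * x)) ^+ 2 <=
      bitE phi 0 N (fun x => ecos ((h * (2 ^ a) ^ n)%:R * x)) ^+ 2 +
      bitE phi 0 N (fun x => esin ((h * (2 ^ a) ^ n)%:R * x)) ^+ 2) ->
    {ae mu, forall x,
      mean (fun n => f ((h * (2 ^ a) ^ n)%:R * x)) N @[N --> \oo] --> 0}.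
  move=> cf f1 fper flip fle.
  have E n x : f ((h * (2 ^ a) ^ n)%:R * x) = f (h%:R * (((2 ^ a) ^ n)%:R * x)).
    by rewrite natrM mulrA.
  have means0 : \int[mu]_x f (h%:R * (((2 ^ a) ^ n)%:R * x)) @[n --> \oo] --> 0.
    have -> : (fun n => \int[mu]_x f (h%:R * (((2 ^ a) ^ n)%:R * x))) =
        (fun n => \int[mu]_x f ((h * (2 ^ a) ^ n)%:R * x)).
      by apply/funext => n; apply: eq_Rintegral => x _; rewrite E.
    exact: means_power_of_two_cvg0.
  have fper' x n : f (h%:R * (x + n%:R)) = f (h%:R * x).
    by rewrite mulrDr -natrM fper.
  have flip' x y : `|f (h%:R * x) - f (h%:R * y)| <= pi *+ 2 * h%:R * `|x - y|.
    by apply: le_trans (flip _ _) _; rewrite -mulrBr normrM normr_nat mulrA.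
  apply: filterS (@ae_means_power_of_two (fun x => f (h%:R * x)) (pi *+ 2 * h%:R)
    a a0 (continuous_scale cf) (fun x => f1 _) fper' flip' means0) => x.
  by under [X in _ -> X @ _ --> _]eq_fun do under eq_fun do rewrite E.
have mc := main _ continuous_ecos ecos_le1 ecosDn ecos_lip
  (fun n N => ler_wpDr (sqr_ge0 _) (lexx _)).
have ms := main _ continuous_esin esin_le1 esinDn esin_lip
  (fun n N => ler_wpDl (sqr_ge0 _) (lexx _)).
by apply: filterS2 mc ms => x.
Qed.

(** The endpoint x = 1 is excluded because all means of e(2^n) equal 1. *)
Lemma ae_absolutely_normal : {ae mu, forall x, absolutely_normal x}.
Proof.
have means : {ae mu, forall x, forall b h, (2 <= b)%N -> (0 < h)%N ->
    mean (fun n => ecos ((h * b ^ n)%:R * x)) N @[N --> \oo] --> 0 /\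
    mean (fun n => esin ((h * b ^ n)%:R * x)) N @[N --> \oo] --> 0}.
  apply: ae_foralln => b; apply: ae_foralln => h.
  have [b2|_] := leqP 2 b; last by apply: nearW.
  have [h0|_] := ltnP 0 h; last by apply: nearW.
  by apply: filterS (ae_means b2 h0) => x.
apply: filterS2 means (ae_in_unit_interval phi01 nuE mu_conv) => x H /andP[x0 x1] b b2.
apply: normal_of_vanishing_means => //; last 2 first.
- by move=> h h0; case: (H b h b2 h0).
- by move=> h h0; case: (H b h b2 h0).
rewrite x0 lt_neqAle x1 andbT; apply/eqP => xE.
have [+ _] := H 2%N 1%N isT isT; rewrite xE.
have -> : (fun n => ecos ((1 * 2 ^ n)%:R * 1) : R) = (fun=> 1).
  by apply/funext => n; rewrite mul1n mulr1 -[_%:R]add0r ecosDn ecos0.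
move=> H0; have /eqP : (1 : R) = 0.
  exact: (cvg_unique (@Rhausdorff R) (@cvg_mean_cst R 1) H0).
by rewrite oner_eq0.
Qed.

End almost_everywhere_means.


(** * Absolute normality *)

Theorem theorem1p2 (R : realType) (phi : nat -> R)
    (phi01 : forall n, (1 <= n)%N -> 0 < phi n < 1)
    (phi_mono : forall m n, (1 <= m)%N -> (m <= n)%N -> phi n <= phi m)
    (phi_to0 : phi n @[n --> \oo] --> 0)
    (nu : nat -> probability R R)
    (nuE : forall n, (1 <= n)%N -> forall A : set R,
       measurable A ->
       nu n A = ((2^-1 * (1 + phi n))%:E * \d_(0%R : R) A +
                 (2^-1 * (1 - phi n))%:E * \d_(2%R ^- n : R)%R A)%E)
    (mu : probability R R)
    (mu_conv : is_infinite_convolution nu mu) :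
  {ae mu, forall x, absolutely_normal x}.
Proof.
exact: (ae_absolutely_normal phi01 phi_mono phi_to0 nuE mu_conv).
Qed.
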